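(* For every free link $L$ there exist an integer $n\ge 1$ and a free braid $\beta\in fB_n$ such that the closure $\mathrm{Cl}(\beta)$ is isotopic to $L$, i.e. $\mathrm{Cl}(\beta)$ and $L$ are equal as free links.
   Context: **Framed 4-graphs.** A framed 4-graph is a finite graph (loops and multiple edges allowed) all of whose vertices have degree 4, such that at every vertex the four emanating half-edges are split into two pairs of formally opposite half-edges. Circle components without vertices are also allowed, and there is at least one component. Passing at each vertex from a half-edge to its opposite one decomposes the graph into closed curves, called unicursal components. No embedding in a surface is given. **Free links.** A free link is an equivalence class of framed 4-graphs modulo isomorphism (preserving the framing) and the following three Reidemeister moves and their inverses. Equivalent graphs are called isotopic. (1) First move: addition/removal of a vertex at which a loop edge is attached along two non-opposite half-edges. That is, a unicursal component passes twice consecutively through that vertex, and the vertex together with the loop is erased from the strand. (2) Second move: addition/removal of two vertices $a,b$ forming a bigon, i.e. joined by two edges which are non-opposite at $a$ and non-opposite at $b$. That is, each of two arcs of unicursal components passes consecutively through $a$ and $b$, and both vertices are erased from both arcs. (3) Third move: for a triangle formed by three vertices and three edges, where two triangle edges meeting at a vertex are non-opposite, so that three arcs of unicursal components pairwise meet in the three vertices, each arc passing consecutively through two of them, the order of the two vertices is reversed along each of the three arcs. **Free braids.** The $n$-strand free braid group $fB_n$ is the group with generators $\sigma_1,\dots,\sigma_{n-1},\zeta_1,\dots,\zeta_{n-1}$ and relations - $\sigma_i\sigma_j=\sigma_j\sigma_i$, $\zeta_i\zeta_j=\zeta_j\zeta_i$, $\zeta_i\sigma_j=\sigma_j\zeta_i$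 for $|i-j|>1$; - $\sigma_i\sigma_{i+1}\sigma_i=\sigma_{i+1}\sigma_i\sigma_{i+1}$, $\zeta_i\zeta_{i+1}\zeta_i=\zeta_{i+1}\zeta_i\zeta_{i+1}$, $\sigma_i\zeta_{i+1}\zeta_i=\zeta_{i+1}\zeta_i\sigma_{i+1}$ for $1\le i\le n-2$; - $\zeta_i^2=1$, $\sigma_i^2=1$, $\sigma_i\zeta_i=\zeta_i\sigma_i$ for $1\le i\le n-1$. A word in the generators is drawn, from top to bottom, as a flat virtual braid diagram with $n$ descending strands: $\sigma_i$ is a flat crossing, and $\zeta_i$ a virtual crossing, of the strands in positions $i$ and $i+1$. **Closure.** The closure $\mathrm{Cl}(\beta)$ is obtained by joining, for each $i=1,\dots,n$, the $i$-th lower endpoint of the diagram to the $i$-th upper endpoint by simple disjoint arcs. It is regarded as a framed 4-graph whose vertices are the flat crossings, with opposite half-edges those belonging to the same strand; virtual crossings are not vertices. Its class as a free link depends only on $\beta\in fB_n$. *)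

(* Defs.v *)
From HB Require Import structures.
From Stdlib Require Import Relation_Operators.
From mathcomp Require Import all_boot perm boolp.

Set Implicit Arguments.
Unset Strict Implicit.
Unset Printing Implicit Defensive.

Section FirstReturn.
Variable T : finType.
Implicit Types (s : T -> T) (A : {pred T}).

(* The first point of A among s x, s (s x) and so on; meaningful for s injective
   when the s-orbit of x meets A. *)
Definition first_return s A (x : T) : T :=
  iter (find [in A] (traject s (s x) (order s x))).+1 s x.

Lemma first_returnP s A x : injective s -> x \in A ->
  exists k, [/\ (0 < k)%N, first_return s A x = iter k s x, iter k s x \in A
              & forall j, (0 < j < k)%N -> iter j s x \notin A].
Proof.
move=> s_inj xA; rewrite /first_return.
set o := traject _ _ _; set k := find _ _.
have o_gt0 : (0 < order s x)%N by rewrite order_gt0.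
have iterE j : iter j s (s x) = iter j.+1 s x by rewrite -iterSr.
have hasA : has [in A] o.
  apply/hasP; exists x => //; apply/trajectP; exists (order s x).-1.
    by rewrite ltn_predL.
  by rewrite iterE prednK // iter_order.
have k_lt : (k < order s x)%N by rewrite -[ltnRHS](size_traject s (s x)) -has_find.
have : nth (s x) o k \in A := nth_find (s x) hasA.
rewrite nth_traject // iterE => kA.
exists k.+1; split=> // -[|j] //= jk.
have : nth (s x) o j \in A = false := before_find (s x) (jk : (j < find [in A] o)%N).
by rewrite nth_traject ?(ltn_trans _ k_lt) // iterE /= => ->.
Qed.

Lemma first_return_in s A x : injective s -> x \in A -> first_return s A x \in A.
Proof. by move=> s_inj xA; have [k [_ -> ]] := first_returnP s_inj xA. Qed.

Lemma first_return_eq s A x k : injective s -> x \in A ->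
    (0 < k)%N -> iter k s x \in A ->
    (forall j, (0 < j < k)%N -> iter j s x \notin A) ->
  first_return s A x = iter k s x.
Proof.
move=> s_inj xA k0 kA kmin.
have [l [l0 -> lA lmin]] := first_returnP s_inj xA.
have [lk|kl|-> //] := ltngtP l k.
- by have := kmin l; rewrite l0 lk lA => /(_ isT).
- by have := lmin k; rewrite k0 kl kA => /(_ isT).
Qed.

Lemma first_return_can s s' A x : cancel s s' -> cancel s' s -> x \in A ->
  first_return s' A (first_return s A x) = x.
Proof.
move=> sK s'K xA.
have [k [k0 -> kA kmin]] := first_returnP (can_inj sK) xA.
have iterK j : (j <= k)%N -> iter j s' (iter k s x) = iter (k - j) s x.
  elim: j => [|j IH] jk; first by rewrite subn0.
  by rewrite iterS IH ?(ltnW jk) // -subSS subSn // sK.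
have xE : iter k s' (iter k s x) = x by rewrite iterK // subnn.
rewrite (@first_return_eq _ _ _ k (can_inj s'K)) ?xE // => j /andP[j0 jk].
rewrite iterK ?(ltnW jk) // kmin // subn_gt0 jk /=.
by rewrite ltn_subrL j0 k0.
Qed.

End FirstReturn.

(* Vertices and half-edges; [opp] is the framing, [mate h] is the other half
   of the edge containing h, and [circles] counts the circle components. *)
Record framed4graph := Framed4Graph {
  vertex : finType;
  half_edge : finType;
  vert : half_edge -> vertex;
  opp : half_edge -> half_edge;
  mate : half_edge -> half_edge;
  circles : nat;
  degree4 : forall v, #|[set h | vert h == v]| = 4;
  vert_opp : forall h, vert (opp h) = vert h;
  oppK : involutive opp;
  opp_neq : forall h, opp h != h;
  mateK : involutive mate;
  mate_neq : forall h, mate h != h;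
  nonempty : (0 < #|vertex| + circles)%N
}.

Definition framed_iso (G H : framed4graph) : Prop :=
  exists (f : vertex G -> vertex H) (g : half_edge G -> half_edge H),
    [/\ bijective f /\ bijective g,
        forall h, vert (g h) = f (vert h),
        forall h, opp (g h) = g (opp h),
        forall h, mate (g h) = g (mate h)
      & circles G = circles H].

(* [erase G S] removes the vertices of S from G, joining opposite half-edges
   at each of them.  A unicursal component with all its vertices in S becomes a
   circle. *)
Section Erase.
Variables (G : framed4graph) (S : {set vertex G}).
Let E := half_edge G.

Definition kept : {pred E} := [pred h | vert h \notin S].

Definition next_half (h : E) : E := mate (opp h).
Let prev_half (h : E) : E := opp (mate h).
Let next_halfK : cancel next_half prev_half.
Proof. by move=> h; rewrite /prev_half mateK oppK. Qed.
Let prev_halfK : cancel prev_half next_half.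
Proof. by move=> h; rewrite /next_half oppK mateK. Qed.

Definition component_rel : rel E := [rel x y | (y == opp x) || (y == mate x)].

Definition swallowed : {pred E} :=
  [pred h | [forall k, connect component_rel h k ==> (vert k \in S)]].

Definition erase_half := {h : E | vert h \notin S}.
Definition erase_vertex := {v : vertex G | v \notin S}.

Definition erase_vert (h : erase_half) : erase_vertex := Sub (vert (val h)) (valP h).

Fact erase_opp_subproof (h : erase_half) : vert (opp (val h)) \notin S.
Proof. by rewrite vert_opp (valP h). Qed.
Definition erase_opp (h : erase_half) : erase_half :=
  Sub (opp (val h)) (erase_opp_subproof h).

Fact erase_mate_subproof (h : erase_half) :
  vert (first_return next_half kept (opp (val h))) \notin S.
Proof.
have hA : opp (val h) \in kept by rewrite inE vert_opp (valP h).
exact: first_return_in (can_inj next_halfK) hA.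
Qed.
Definition erase_mate (h : erase_half) : erase_half :=
  Sub (first_return next_half kept (opp (val h))) (erase_mate_subproof h).

Definition erase_circles : nat := circles G + n_comp component_rel swallowed.

Fact erase_degree4 v : #|[set h | erase_vert h == v]| = 4.
Proof.
rewrite -(degree4 (val v)) -(card_imset _ val_inj); apply: eq_card => h.
rewrite inE; apply/imsetP/eqP => [[k + ->]|hv].
  by rewrite inE => /eqP <-.
have hS : vert h \notin S by rewrite hv (valP v).
by exists (Sub h hS); rewrite // inE -val_eqE /= hv.
Qed.

Fact erase_vert_opp h : erase_vert (erase_opp h) = erase_vert h.
Proof. by apply: val_inj; rewrite /= vert_opp. Qed.

Fact erase_oppK : involutive erase_opp.
Proof. by move=> h; apply: val_inj; rewrite /= oppK. Qed.

Fact erase_opp_neq h : erase_opp h != h.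
Proof. by rewrite -val_eqE /= opp_neq. Qed.

Let iter_opp k h : iter k next_half (opp h) = opp (iter k prev_half h).
Proof. by elim: k => //= k ->; rewrite /next_half oppK /prev_half oppK. Qed.

Fact erase_mateK : involutive erase_mate.
Proof.
move=> h; apply: val_inj => /=.
have hA : opp (val h) \in kept by rewrite inE vert_opp (valP h).
have [k [k0 -> kA kmin]] := first_returnP (can_inj next_halfK) hA.
have iterK j : (j <= k)%N ->
    iter j next_half (opp (iter k next_half (opp (val h))))
      = opp (iter (k - j) next_half (opp (val h))).
  move=> jk; rewrite iter_opp; congr opp.
  elim: j jk => [|j IH] jk; first by rewrite subn0.
  by rewrite iterS IH ?(ltnW jk) // -subSS subSn // next_halfK.
rewrite (@first_return_eq _ _ _ _ k (can_inj next_halfK)) ?iterK ?subnn //=.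
- exact: oppK.
- by rewrite inE vert_opp -[_ \notin S]/(_ \in kept).
- by rewrite oppK inE (valP h).
- move=> j /andP[j0 jk]; rewrite iterK ?(ltnW jk) // inE vert_opp.
  by rewrite -[_ \notin S]/(_ \in kept) kmin // subn_gt0 jk /= ltn_subrL j0 k0.
Qed.

Let iter_next_neq k h : iter k next_half (opp h) != h.
Proof.
have [n] := ubnP k; elim: n k h => // n IH [|[|k]] h kn.
- exact: opp_neq.
- by rewrite /= /next_half oppK mate_neq.
apply/eqP => kh; have /eqP[] := IH k (opp (mate h)) (ltnW kn).
rewrite oppK; apply: (can_inj next_halfK).
rewrite [RHS]/next_half oppK mateK -[RHS]kh -iterS.
have e : next_half (opp h) = mate h by rewrite /next_half oppK.
by rewrite [RHS]iterSr e.
Qed.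

Fact erase_mate_neq h : erase_mate h != h.
Proof.
have hA : opp (val h) \in kept by rewrite inE vert_opp (valP h).
have [k [_ kE _ _]] := first_returnP (can_inj next_halfK) hA.
by rewrite -val_eqE /= kE iter_next_neq.
Qed.

Let component_sym : connect_sym component_rel.
Proof.
apply: sym_connect_sym => x y /=; congr orb.
- by apply/eqP/eqP => ->; rewrite oppK.
- by apply/eqP/eqP => ->; rewrite mateK.
Qed.

Fact erase_nonempty : (0 < #|{: erase_vertex}| + erase_circles)%N.
Proof.
have [v vS|allS] := pickP [pred v | v \notin S].
  by rewrite addn_gt0; apply/orP; left; apply/card_gt0P; exists (Sub v vS).
have := nonempty G; rewrite !addn_gt0 => /orP[/card_gt0P[v _]|->]; last first.
  by rewrite orbT.
have : (0 < #|[set h | vert h == v]|)%N by rewrite degree4.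
move=> /card_gt0P[h _]; apply/orP; right; apply/orP; right.
apply/card_gt0P; exists (root component_rel h).
rewrite !inE roots_root //=; apply/forallP => k; apply/implyP => _.
exact: negbFE (allS _).
Qed.

Definition erase : framed4graph :=
  Framed4Graph erase_degree4 erase_vert_opp erase_oppK erase_opp_neq
    erase_mateK erase_mate_neq erase_nonempty.

End Erase.

Section Remate.
Variables (G : framed4graph) (s : {perm half_edge G}).

Definition remate_mate h := s (mate (s^-1%g h)).

Fact remate_mateK : involutive remate_mate.
Proof. by move=> h; rewrite /remate_mate permK mateK permKV. Qed.

Fact remate_mate_neq h : remate_mate h != h.
Proof. by rewrite -{2}(permKV s h) (inj_eq perm_inj) mate_neq. Qed.

Definition remate : framed4graph :=
  Framed4Graph (@degree4 G) (@vert_opp G) (@oppK G) (@opp_neq G)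
    remate_mateK remate_mate_neq (@nonempty G).

End Remate.

(* The loop is the edge formed by h and mate h. *)
Definition reidemeister1 (G H : framed4graph) : Prop :=
  exists h : half_edge G,
    [/\ vert (mate h) = vert h, mate h != opp h
      & framed_iso (erase [set vert h]) H].

(* The edges of the bigon are (h, mate h) and (k, mate k), with h and k at one
   vertex and mate h and mate k at the other. *)
Definition reidemeister2 (G H : framed4graph) : Prop :=
  exists h k : half_edge G,
    [/\ vert h = vert k /\ vert (mate h) = vert (mate k),
        vert h != vert (mate h),
        h != k,
        k != opp h /\ mate k != opp (mate h)
      & framed_iso (erase [set vert h; vert (mate h)]) H].

(* The edges of the triangle are (a1, b1), (b2, c1) and (c2, a2).  The arc
   through a and b reads  x - opp a1, a1 - b1, opp b1 - y; exchanging opp a1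
   and opp b1 turns it into  x - opp b1, b1 - a1, opp a1 - y. *)
Definition reidemeister3 (G H : framed4graph) : Prop :=
  exists a1 a2 b1 b2 c1 c2 : half_edge G,
    [/\ [/\ vert a1 = vert a2, vert b1 = vert b2 & vert c1 = vert c2],
        [/\ vert a1 != vert b1, vert b1 != vert c1 & vert c1 != vert a1],
        [/\ mate a1 = b1, mate b2 = c1 & mate c2 = a2],
        [/\ a1 != a2 /\ a2 != opp a1, b1 != b2 /\ b2 != opp b1
          & c1 != c2 /\ c2 != opp c1]
      & framed_iso (remate (tperm (opp a1) (opp b1) * tperm (opp b2) (opp c1)
                              * tperm (opp c2) (opp a2))%g) H].

Inductive isotopic : framed4graph -> framed4graph -> Prop :=
| isotopic_iso G H of framed_iso G H : isotopic G H
| isotopic_move1 G H of reidemeister1 G H : isotopic G H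
| isotopic_move2 G H of reidemeister2 G H : isotopic G H
| isotopic_move3 G H of reidemeister3 G H : isotopic G H
| isotopic_sym G H of isotopic G H : isotopic H G
| isotopic_trans G H K of isotopic G H & isotopic H K : isotopic G K.

Lemma isotopic_refl G : isotopic G G.
Proof.
apply: isotopic_iso; exists id, id; split=> //.
by split; exists id.
Qed.

Record free_link := FreeLink {
  diagrams : framed4graph -> Prop;
  diagramsP : exists G, diagrams = isotopic G
}.

Definition free_link_of (G : framed4graph) : free_link :=
  FreeLink (ex_intro (fun H => isotopic G = isotopic H) G erefl).

Lemma free_link_inj : injective diagrams.
Proof.
by move=> [P p] [Q q] /= PQ; case: _ / PQ q => q; congr FreeLink; apply: Prop_irrelevance.
Qed.

Lemma free_link_ofP G H : free_link_of G = free_link_of H <-> isotopic G H.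
Proof.
split=> [[GH]|GH]; first by rewrite GH; apply: isotopic_refl.
have E : isotopic G = isotopic H.
  apply/funext => K; apply/propext; split; apply: isotopic_trans => //.
  exact: isotopic_sym.
exact: free_link_inj.
Qed.

(* Indices start at 0: inl i is sigma_(i+1) and inr i is zeta_(i+1), in the usual numbering. *)
Definition generator (n : nat) : Type := ('I_n.-1 + 'I_n.-1)%type.
Definition sigma n (i : 'I_n.-1) : generator n := inl i.
Definition zeta n (i : 'I_n.-1) : generator n := inr i.

(* Each generator is its own inverse, so words without formal inverses
   suffice. *)
Definition word (n : nat) : Type := seq (generator n).

Inductive braid_relator n : word n -> word n -> Prop :=
| far_sigma_sigma (i j : 'I_n.-1) : (i.+1 < j)%N || (j.+1 < i)%N ->
    braid_relator [:: sigma i; sigma j] [:: sigma j; sigma i]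
| far_zeta_zeta (i j : 'I_n.-1) : (i.+1 < j)%N || (j.+1 < i)%N ->
    braid_relator [:: zeta i; zeta j] [:: zeta j; zeta i]
| far_zeta_sigma (i j : 'I_n.-1) : (i.+1 < j)%N || (j.+1 < i)%N ->
    braid_relator [:: zeta i; sigma j] [:: sigma j; zeta i]
| triple_sigma (i j : 'I_n.-1) : j = i.+1 :> nat ->
    braid_relator [:: sigma i; sigma j; sigma i] [:: sigma j; sigma i; sigma j]
| triple_zeta (i j : 'I_n.-1) : j = i.+1 :> nat ->
    braid_relator [:: zeta i; zeta j; zeta i] [:: zeta j; zeta i; zeta j]
| triple_mixed (i j : 'I_n.-1) : j = i.+1 :> nat ->
    braid_relator [:: sigma i; zeta j; zeta i] [:: zeta j; zeta i; sigma j]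
| zeta_zeta (i : 'I_n.-1) : braid_relator [:: zeta i; zeta i] [::]
| sigma_sigma (i : 'I_n.-1) : braid_relator [:: sigma i; sigma i] [::]
| sigma_zeta (i : 'I_n.-1) :
    braid_relator [:: sigma i; zeta i] [:: zeta i; sigma i].

Inductive braid_step n : word n -> word n -> Prop :=
  BraidStep u v x y of braid_relator x y :
    braid_step (u ++ x ++ v) (u ++ y ++ v).

Definition braid_equiv n : word n -> word n -> Prop :=
  clos_refl_sym_trans (word n) (@braid_step n).

Definition braid_equivb n : rel (word n) := fun u v => `[< braid_equiv u v >].

Fact braid_equivb_equiv n : equiv_class_of (@braid_equivb n).
Proof.
split=> [u|u v|v u w].
- exact/asboolP/rst_refl.
- by apply/asboolP/asboolP; apply: rst_sym.
- by move=> /asboolP vu /asboolP uw; apply/asboolP; exact: rst_trans vu uw.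
Qed.

Canonical braid_equiv_rel n := EquivRelPack (@braid_equivb_equiv n).

Definition fB (n : nat) := {eq_quot (braid_equiv_rel n)}%qT.
HB.instance Definition _ n := Choice.on (fB n).
HB.instance Definition _ n := EqQuotient.on (fB n).

Section BraidGroup.
Variable n : nat.
Local Open Scope quotient_scope.
Implicit Types u v w : word n.

Lemma fB_eqP u v : reflect (braid_equiv u v) (u == v %[mod fB n]).
Proof. by rewrite eqmodE; apply: asboolP. Qed.

Lemma braid_equiv_cat w1 w2 u v :
  braid_equiv u v -> braid_equiv (w1 ++ u ++ w2) (w1 ++ v ++ w2).
Proof.
elim=> [_ _ [u' v' x y xy]|x|x y _ yx|x y z _ xy _ yz].
- apply: rst_step; have := @BraidStep n (w1 ++ u') (v' ++ w2) x y xy.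
  by rewrite -!catA.
- exact: rst_refl.
- exact: rst_sym.
- exact: rst_trans xy yz.
Qed.

Lemma braid_equiv_revK u : braid_equiv (rev u ++ u) [::].
Proof.
elim: u => [|a u IH]; first exact: rst_refl.
apply: rst_trans IH.
rewrite rev_cons cat_rcons.
apply: (@braid_equiv_cat (rev u) u [:: a; a] [::]); apply: rst_step.
by case: a => i; apply: (@BraidStep n [::] [::] [:: _; _] [::]); constructor.
Qed.

Definition fB_mul (x y : fB n) : fB n := \pi_(fB n) (repr x ++ repr y).
Definition fB_one : fB n := \pi_(fB n) [::].
Definition fB_inv (x : fB n) : fB n := \pi_(fB n) (rev (repr x)).

Lemma fB_mulE u v : fB_mul (\pi_(fB n) u) (\pi_(fB n) v) = \pi_(fB n) (u ++ v).
Proof.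
have reprE w : braid_equiv (repr (\pi_(fB n) w)) w by apply/fB_eqP; rewrite reprK.
apply/eqP/fB_eqP; apply: rst_trans.
  exact: (@braid_equiv_cat [::] _ _ _ (reprE u)).
by have := @braid_equiv_cat u [::] _ _ (reprE v); rewrite !cats0.
Qed.

Fact fB_mulA : associative fB_mul.
Proof.
move=> x y z; rewrite -[x]reprK -[y]reprK -[z]reprK.
rewrite (fB_mulE (repr y) (repr z)) (fB_mulE (repr x) (repr y)).
by rewrite (fB_mulE (repr x) (repr y ++ repr z)) (fB_mulE (repr x ++ repr y)) catA.
Qed.

Fact fB_mul1 : left_id fB_one fB_mul.
Proof. by move=> x; rewrite -[x]reprK (fB_mulE [::]). Qed.

Fact fB_mulr1 : right_id fB_one fB_mul.
Proof. by move=> x; rewrite -[x]reprK (fB_mulE _ [::]) cats0. Qed.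

Fact fB_mulV : left_inverse fB_one fB_inv fB_mul.
Proof.
move=> x; rewrite -[x in fB_mul _ x]reprK fB_mulE.
exact/eqP/fB_eqP/braid_equiv_revK.
Qed.

Fact fB_mulrV : right_inverse fB_one fB_inv fB_mul.
Proof.
move=> x; rewrite -[x in fB_mul x _]reprK fB_mulE.
apply/eqP/fB_eqP; rewrite -{1}[repr x]revK; exact: braid_equiv_revK.
Qed.

HB.instance Definition _ :=
  isGroup.Build (fB n) fB_mulA fB_mul1 fB_mulr1 fB_mulV fB_mulrV.

End BraidGroup.

(* The diagram of w has levels 0, ..., size w: the k-th letter of w lies
   between the levels k and k.+1, and the closing arcs join level size w to
   level 0.  The number of strands is n.+1. *)
Section Closure.
Variables (n : nat) (w : word n.+1).

Definition level := 'I_(size w).+1.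
Definition point : Type := (level * 'I_n.+1)%type.

Definition letter (k : level) : option (generator n.+1) := onth w k.

Definition left_pos (i : 'I_n) : 'I_n.+1 := widen_ord (leqnSn n) i.
Definition right_pos (i : 'I_n) : 'I_n.+1 := lift ord0 i.

Definition letter_perm (a : option (generator n.+1)) : {perm 'I_n.+1} :=
  match a with
  | Some (inl i) | Some (inr i) => tperm (left_pos i) (right_pos i)
  | None => 1%g
  end.

(* Following the strands downwards; the last level goes back to level 0. *)
Definition descend (x : point) : point := (ordS x.1, letter_perm (letter x.1) x.2).

Definition flat_crossing (k : level) : bool :=
  if letter k is Some (inl _) then true else false.

(* The points right above a flat crossing, on one of its two strands. *)
Definition entering : {pred point} := fun x =>
  if letter x.1 is Some (inl i) then (x.2 == left_pos i) || (x.2 == right_pos i)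
  else false.

Definition closure_vertex := {k : level | flat_crossing k}.

(* (x, false) and (x, true) are the half-edges through which the strand of x
   enters and leaves the crossing just below x. *)
Definition closure_half := ({x : point | x \in entering} * bool)%type.

Fact closure_vert_subproof (h : closure_half) : flat_crossing (val h.1).1.
Proof.
have := valP h.1; rewrite unfold_in /entering /flat_crossing.
by case: (letter _) => [[]|].
Qed.
Definition closure_vert (h : closure_half) : closure_vertex :=
  Sub (val h.1).1 (closure_vert_subproof h).

Definition closure_opp (h : closure_half) : closure_half := (h.1, ~~ h.2).

Fact descend_inj : injective descend.
Proof.
move=> [k p] [l q] /eqP; rewrite xpair_eqE => /andP[/eqP/= kl /eqP/=].
by rewrite -(can_inj (@ordSK _) kl) => /perm_inj ->.
Qed.

Fact closure_down_subproof (x : {x : point | x \in entering}) :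
  first_return descend entering (val x) \in entering.
Proof. exact: first_return_in descend_inj (valP x). Qed.
Definition closure_down (x : {x : point | x \in entering})
    : {x : point | x \in entering} :=
  Sub (first_return descend entering (val x)) (closure_down_subproof x).

Fact closure_up_subproof (x : {x : point | x \in entering}) :
  first_return (finv descend) entering (val x) \in entering.
Proof. exact: first_return_in (finv_inj descend_inj) (valP x). Qed.
Definition closure_up (x : {x : point | x \in entering})
    : {x : point | x \in entering} :=
  Sub (first_return (finv descend) entering (val x)) (closure_up_subproof x).

Definition closure_mate (h : closure_half) : closure_half :=
  if h.2 then (closure_down h.1, false) else (closure_up h.1, true).

(* The closed strands that meet no flat crossing. *)
Definition closure_circles : nat :=
  fcard descend [pred x | [forall y, fconnect descend x y ==> (y \notin entering)]].

Fact closure_degree4 v : #|[set h | closure_vert h == v]| = 4.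
Proof.
set k := val v.
have [i E] : exists i, letter k = Some (inl i).
  have := valP v; rewrite -/k /flat_crossing.
  by case: (letter k) => [[i|]|] // _; exists i.
have inP p : ((k, p) \in entering) = (p == left_pos i) || (p == right_pos i).
  by rewrite unfold_in /entering /= E.
have lP : (k, left_pos i) \in entering by rewrite inP eqxx.
have rP : (k, right_pos i) \in entering by rewrite inP eqxx orbT.
pose l : {x : point | x \in entering} := Sub (k, left_pos i) lP.
pose r : {x : point | x \in entering} := Sub (k, right_pos i) rP.
have lr : l != r.
  by rewrite -val_eqE /= xpair_eqE eqxx /= -val_eqE /= /bump /= add1n neq_ltn ltnSn.
have -> : [set h | closure_vert h == v] = setX [set l; r] [set: bool].
  apply/setP => -[x b]; rewrite !inE /= andbT -!val_eqE /= -/k.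
  case: x => [[k' p] xP] /=; rewrite !xpair_eqE.
  case: (eqVneq k' k) => [kk|kk] /=; last exact: negbTE.
  by rewrite -inP -kk xP eqxx.
by rewrite cardsX cards2 lr cardsT card_bool.
Qed.

Fact closure_vert_opp h : closure_vert (closure_opp h) = closure_vert h.
Proof. exact: val_inj. Qed.

Fact closure_oppK : involutive closure_opp.
Proof. by case=> x b; rewrite /closure_opp negbK. Qed.

Fact closure_opp_neq h : closure_opp h != h.
Proof. by case: h => x []; rewrite xpair_eqE andbF. Qed.

Fact closure_mateK : involutive closure_mate.
Proof.
move=> [x []]; rewrite /closure_mate /=; congr pair; apply: val_inj => /=.
- exact: first_return_can (finv_f descend_inj) (f_finv descend_inj) (valP x).
- exact: first_return_can (f_finv descend_inj) (finv_f descend_inj) (valP x).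
Qed.

Fact closure_mate_neq h : closure_mate h != h.
Proof. by case: h => x []; rewrite /closure_mate xpair_eqE andbF. Qed.

Fact closure_nonempty : (0 < #|{: closure_vertex}| + closure_circles)%N.
Proof.
have [k kP|none] := pickP flat_crossing.
  by rewrite addn_gt0; apply/orP; left; apply/card_gt0P; exists (Sub k kP).
rewrite addn_gt0; apply/orP; right; apply/card_gt0P.
exists (froot descend (ord0, ord0)).
rewrite !inE roots_root /=; last exact: (fconnect_sym descend_inj).
apply/forallP => y; apply/implyP => _.
rewrite unfold_in /entering; have := none y.1; rewrite /flat_crossing.
by case: (letter _) => [[]|].
Qed.

Definition braid_closure : framed4graph :=
  Framed4Graph closure_degree4 closure_vert_opp closure_oppK closure_opp_neq
    closure_mateK closure_mate_neq closure_nonempty.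

End Closure.

(* The free link of [braid_closure w] depends only on the class of w in
   fB n.+1, so the choice of the representative is immaterial. *)
Definition Cl n (beta : fB n.+1) : framed4graph := braid_closure (repr beta).

(* Main.v *)
Require Import Defs.
From mathcomp Require Import all_boot.
From mathcomp Require Import fingroup perm zify.

Set Implicit Arguments.
Unset Strict Implicit.
Unset Printing Implicit Defensive.

(* A framed 4-graph is encoded by a finite set of strands, the list of the pairs
   of strands that cross one after the other, and the permutation that says how
   the ends of the strands are glued to their beginnings; the code determines the
   graph up to isomorphism.  The closure of a braid word has a code in which the
   virtual letters leave no trace, so the virtual relations do not change the
   closure, commuting distant flat crossings exchanges disjoint consecutive pairs,
   and the relations sigma^2 = 1 and sigma sigma' sigma = sigma' sigma sigma' become
   the second and third Reidemeister moves: the class of the closure depends only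
   on the braid.  Conversely, orient the unicursal components of a graph and cut
   every edge: this is a code with one strand for each edge, and every code comes
   from a braid word, because virtual letters bring any two strands together. *)

(** * Codes of framed 4-graphs *)

(** Framed graphs carry no coordinates, and erasing vertices even changes the type of half-edges. A
    code replaces a half-edge by the triple of its time, its strand and its direction. Such triples
    can be followed through every move, so moves become rewritings of lists, and the only thing left
    to track is which crossing a moving point meets next. Circle components have no half-edges,
    which is why they are recovered from cycles of the gluing that meet no crossing. Times order all
    crossings linearly, like heights in a braid diagram, although a graph supplies no such order.
    Cutting every edge removes the conflict: each strand then meets at most one crossing, so any
    enumeration of the vertices is compatible with the strands. The orientation used in cutting
    exists because going straight ahead never runs along a component in both directions. *)

Section Chords.
Variable T : finType.
Implicit Types (p : {perm T}) (c : seq {set T}) (a b : T) (t m : nat).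

(** The default [set0] means that nothing crosses after the end of the list. *)
Definition on c t a := a \in nth set0 c t.

(* A point moving along the strand a from time k on, and following the gluing p
   at the end of each strand, meets its next crossing at time t on the strand b. *)
Inductive reaches p c : nat -> T -> nat -> T -> Prop :=
| Reaches_here k a t of k <= t & on c t a
    & (forall j, k <= j < t -> ~~ on c j a) : reaches p c k a t a
| Reaches_wrap k a t b of (forall j, k <= j -> ~~ on c j a)
    & reaches p c 0 (p a) t b : reaches p c k a t b.

Lemma implyN_absurd {P : Prop} {X b : bool} : (X -> ~~ b) -> X -> b -> P.
Proof. by move=> nb /nb /negP. Qed.

Lemma reaches_inv p c k a t b : reaches p c k a t b ->
  [/\ b = a, k <= t, on c t a & forall j, k <= j < t -> ~~ on c j a] \/
  (forall j, k <= j -> ~~ on c j a) /\ reaches p c 0 (p a) t b.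
Proof. by case; [left|right]. Qed.

Lemma reaches_on p c k a t b : reaches p c k a t b -> on c t b.
Proof. by elim. Qed.

Lemma reaches_fconnect p c k a t b : reaches p c k a t b -> fconnect p a b.
Proof.
elim=> [*|{}k {}a {}t {}b _ _]; first exact: connect0.
exact/connect_trans/fconnect1.
Qed.

(** This uniqueness is what makes a code determine [mate]. *)
Lemma reaches_det p c k a t b t' b' :
  reaches p c k a t b -> reaches p c k a t' b' -> t = t' /\ b = b'.
Proof.
move=> H; elim: H t' b' => {k a t b} [k a t kt ta none|k a t b none _ IH] t' b'.
- case/reaches_inv => [[-> kt' ta' none']|[none' _]].
  + split=> //; have [tt'|tt'|//] := ltngtP t t'.
    * by apply: (implyN_absurd (none' t)); rewrite ?kt.
    * by apply: (implyN_absurd (none t')); rewrite ?kt'.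
  + by apply: (implyN_absurd (none' t)).
- case/reaches_inv => [[_ kt' ta' _]|[_ /IH //]].
  by apply: (implyN_absurd (none t')).
Qed.

Lemma reaches_skip {p c k k' a t b} : k <= k' ->
    (forall j, k <= j < k' -> ~~ on c j a) ->
  reaches p c k a t b <-> reaches p c k' a t b.
Proof.
move=> kk' none; split.
- case/reaches_inv => [[-> kt ta none']|[none' Hr]].
  + have k't : k' <= t.
      by rewrite leqNgt; apply/negP => tk'; apply: (implyN_absurd (none t)); rewrite ?kt.
    by apply: Reaches_here => // j /andP[k'j jt]; apply: none'; rewrite jt andbT; lia.
  + by apply: Reaches_wrap => // j k'j; apply: none'; lia.
- case/reaches_inv => [[-> kt ta none']|[none' Hr]].
  + apply: Reaches_here => // [|j /andP[kj jt]]; first by lia.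
    by have [k'j|jk'] := leqP k' j; [apply: none'|apply: none]; rewrite ?kj ?k'j.
  + apply: Reaches_wrap => // j kj.
    by have [k'j|jk'] := leqP k' j; [apply: none'|apply: none; rewrite ?kj].
Qed.

(** The two codes agree outside the block of times from [m] up to but excluding [m'], and inside it
    they involve the same strands. A path that does not start after the top of the block and before
    its end can only enter it from the top, so in either code it stops at the first crossing of its
    strand in the block. For a strand absent from the block, the block is invisible in both. *)
Lemma reaches_block p c c' m m' k a t b :
    (forall j d, ~~ (m <= j < m') -> on c j d = on c' j d) ->
    (forall j d, m <= j < m' -> on c j d -> exists2 i, m <= i < m' & on c' i d) ->
    (forall j d, m <= j < m' -> on c' j d -> exists2 i, m <= i < m' & on c i d) ->
    reaches p c k a t b -> (k <= m) || (m' <= k) ->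
  exists2 t', reaches p c' k a t' b &
    if m <= t < m' then
      [/\ m <= t' < m', forall j, m <= j < t -> ~~ on c j b
        & forall j, m <= j < t' -> ~~ on c' j b]
    else t' = t.
Proof.
move=> Hout Hcc' Hc'c H.
elim: H => {k a t b} [k a t kt ta none|k a t b none Hr IH] kmm'.
- have [tmm'|tmm'] := boolP (m <= t < m').
  + have [i imm' ia] := Hcc' t a tmm' ta.
    have exi : exists i, (m <= i) && on c' i a by exists i; case/andP: imm' => ->.
    case: (ex_minnP exi) => t' /andP[mt' t'a] t'min.
    have t'i : t' <= i by apply: t'min; rewrite ia; case/andP: imm' => ->.
    have none' j : m <= j < t' -> ~~ on c' j a.
      move=> /andP[mj jt']; apply/negP => ja.
      by have := t'min j; rewrite mj ja leqNgt jt' => /(_ isT).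
    have km : k <= m by lia.
    exists t'; last first.
      by split; [lia | move=> j mjt; apply: none; lia | exact: none'].
    apply: Reaches_here => // [|j kjt']; first by lia.
    have [mj|jm] := leqP m j; first by apply: none'; lia.
    by rewrite -Hout; [apply: none; lia | lia].
  + exists t => //; apply: Reaches_here; rewrite // -?Hout // => j kjt.
    have [jmm'|jmm'] := boolP (m <= j < m'); last by rewrite -Hout // none.
    apply/negP => /(Hc'c _ _ jmm')[i imm' ia].
    by apply: (implyN_absurd (none i)); [lia|].
- have [//|t' Hr' Ht'] := IH _.
  exists t' => //; apply: Reaches_wrap => // j kj.
  have [jmm'|jmm'] := boolP (m <= j < m'); last by rewrite -Hout // none.
  apply/negP => /(Hc'c _ _ jmm')[i imm' ia].
  by apply: (implyN_absurd (none i)); [lia|].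
Qed.

(** The condition bears on the whole cycle of [p] through [a]: such a cycle closes up without
    meeting a vertex, so it is one circle component. *)
Definition free_strand p c : {pred T} :=
  fun a => [forall b, fconnect p a b ==> ~~ has (fun A : {set T} => b \in A) c].

Definition free_strands p c := fcard p (free_strand p c).

Lemma hasP_on c a : reflect (exists t, on c t a) (has (fun A : {set T} => a \in A) c).
Proof.
apply: (iffP (hasP)) => [[A Ac aA]|[t]].
  by exists (index A c); rewrite /on nth_index.
rewrite /on => ta; have tc : t < size c.
  by rewrite ltnNge; apply/negP => ct; rewrite nth_default ?inE in ta.
by exists (nth set0 c t) => //; apply: mem_nth.
Qed.

Lemma eq_free_strands p c c' :
    (forall a, (exists t, on c t a) <-> (exists t, on c' t a)) ->
  free_strands p c = free_strands p c'.
Proof.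
move=> E; apply: eq_n_comp_r => a; rewrite !unfold_in; apply: eq_forallb => b.
by congr (_ ==> ~~ _); apply/hasP_on/hasP_on => /E.
Qed.

(* [coding p c G tm lab ori]: G is the closure of a family of strands indexed by
   T.  At time t the two strands in the t-th set of c cross, and the strand a
   finally continues as the strand [p a].  The half-edge h belongs to the
   crossing at time [tm h], lies on the strand [lab h], and [ori h] holds when it
   leaves the crossing. *)
Record coding p c (G : framed4graph) (tm : half_edge G -> nat)
    (lab : half_edge G -> T) (ori : half_edge G -> bool) : Prop := Coding {
  coding_on h : on c (tm h) (lab h);
  coding_onto t a o : on c t a ->
    exists h, [/\ tm h = t, lab h = a & ori h = o];
  coding_inj h h' : tm h = tm h' -> lab h = lab h' -> ori h = ori h' -> h = h';
  coding_vert h h' : vert h = vert h' <-> tm h = tm h';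
  coding_opp h : [/\ tm (opp h) = tm h, lab (opp h) = lab h & ori (opp h) = ~~ ori h];
  coding_mate h : ori h -> ori (mate h) = false /\
    reaches p c (tm h).+1 (lab h) (tm (mate h)) (lab (mate h));
  coding_circles : circles G = free_strands p c }.

Definition coded p c G := exists tm lab ori, @coding p c G tm lab ori.

Section CodingTheory.
Variables (p : {perm T}) (c : seq {set T}) (G : framed4graph).
Variables (tm : half_edge G -> nat) (lab : half_edge G -> T).
Variable (ori : half_edge G -> bool).
Hypothesis cG : coding p c tm lab ori.
Implicit Types h k : half_edge G.

(** A coding describes the mates of outgoing half-edges only; the rest follows by counting. Since
    [opp] exchanges outgoing and incoming half-edges, there are equally many of each, so the
    injection [mate] from the former to the latter is onto. *)
Lemma coding_mate_ori h : ori (mate h) = ~~ ori h.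
Proof.
have [oh|oh] := boolP (ori h); first by have [->] := coding_mate cG oh.
pose O := [set h | ori h].
have OC : #|O| = #|~: O|.
  rewrite -(card_imset _ (inv_inj (@oppK G))); apply: eq_card => k.
  rewrite !inE; apply/imsetP/idP => [[k' + ->]|ok].
    by rewrite inE; case: (coding_opp cG k') => _ _ -> ->.
  exists (opp k); rewrite ?oppK // inE; by case: (coding_opp cG k) => _ _ ->.
have sub : [set mate h | h in O] \subset ~: O.
  by apply/subsetP => _ /imsetP[k + ->]; rewrite !inE => /(coding_mate cG)[->].
have : h \in ~: O by rewrite !inE.
have /eqP <- : [set mate h | h in O] == ~: O.
  by rewrite eqEcard sub -OC card_imset ?leqnn //; apply: inv_inj (@mateK G).
by case/imsetP => k; rewrite inE => ok ->; rewrite mateK.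
Qed.

Lemma next_half_ori h : ori (next_half h) = ori h.
Proof. by rewrite coding_mate_ori; have [_ _ ->] := coding_opp cG h; rewrite negbK. Qed.

Lemma next_half_reaches h : ori h = false ->
  reaches p c (tm h).+1 (lab h) (tm (next_half h)) (lab (next_half h)).
Proof.
move=> oh; have [tE lE oE] := coding_opp cG h.
by have [|_] := @coding_mate _ _ _ _ _ _ cG (opp h); rewrite ?oE ?oh // tE lE.
Qed.

Lemma coding_reaches_mate h k : ori h -> ori k = false ->
  reaches p c (tm h).+1 (lab h) (tm k) (lab k) -> mate h = k.
Proof.
move=> oh ok Hr; have [om Hm] := coding_mate cG oh.
have [tE lE] := reaches_det Hm Hr.
by apply: (coding_inj cG); rewrite ?om ?ok.
Qed.

Let e := @component_rel G.

Let e_sym : connect_sym e.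
Proof.
apply: sym_connect_sym => x y /=; congr orb.
- by apply/eqP/eqP => ->; rewrite oppK.
- by apply/eqP/eqP => ->; rewrite mateK.
Qed.

Let e_opp h : connect e h (opp h).
Proof. by apply: connect1; rewrite /e /component_rel /= eqxx. Qed.

Let e_mate h : connect e h (mate h).
Proof. by apply: connect1; rewrite /e /component_rel /= eqxx orbT. Qed.

Let e_code h h' : tm h = tm h' -> lab h = lab h' -> connect e h h'.
Proof.
move=> tE lE; have [oE|oE] := boolP (ori h == ori h').
  by rewrite (coding_inj cG tE lE (eqP oE)) connect0.
have <- : opp h = h'; last exact: e_opp.
have [to lo oo] := coding_opp cG h.
by apply: (coding_inj cG); rewrite ?to ?lo ?oo //; move: oE; do 2 case: ori.
Qed.

(** Induction on the time gap: passing straight through the earlier crossing leads to the next one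
    on the strand, which is not later than that of [h']. *)
Let e_strand h h' : lab h = lab h' -> connect e h h'.
Proof.
wlog tt' : h h' / tm h <= tm h' => [W|] lE.
  by case: (leqP (tm h) (tm h')) => [|/ltnW] tt'; [|rewrite e_sym]; apply: W.
have [n] := ubnP (tm h' - tm h); elim: n h tt' lE => // n IH h tt' lE le_n.
have [tE|] := eqVneq (tm h) (tm h'); first exact: e_code.
move=> tne; have {tne} tlt : tm h < tm h' by rewrite ltn_neqAle tne.
wlog oh : h tt' lE le_n tlt / ori h = false.
  have [oh|oh] := boolP (ori h); last by apply=> //; apply: negbTE.
  have [to lo oo] := coding_opp cG h.
  move=> W; apply: connect_trans (e_opp h) _.
  by apply: W; rewrite ?to ?lo ?oo ?oh.
have on' : on c (tm h') (lab h) by rewrite lE; apply: (coding_on cG).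
have := next_half_reaches oh.
case/reaches_inv => [[lE' lt' _ none]|[none _]]; last exact: implyN_absurd (none _) tlt on'.
have le' : tm (next_half h) <= tm h'.
  rewrite leqNgt; apply/negP => lt; by apply: (implyN_absurd (none (tm h'))) => //; lia.
apply: connect_trans (e_opp h) (connect_trans (e_mate _) _).
by rewrite -/(next_half _); apply: IH; rewrite ?lE' //; lia.
Qed.

(** Leave the strand of [h] through its last crossing: the path has to pass to the next strand. *)
Let e_wrap h : exists2 k, connect e h k & reaches p c 0 (p (lab h)) (tm k) (lab k).
Proof.
pose Q := [pred k | (lab k == lab h) && ~~ ori k].
have [k0 k0Q] : exists k, Q k.
  have [k [_ lk ok]] := coding_onto cG false (coding_on cG h).
  by exists k; rewrite /= lk ok eqxx.
case: (arg_maxnP tm k0Q) => k /andP[/eqP lk /negbTE ok] kmax.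
exists (next_half k).
  apply: connect_trans (connect_trans (e_opp k) (e_mate _)).
  by rewrite e_strand ?lk.
have [[_ lt' on' _]|[_]] := reaches_inv (next_half_reaches ok); last by rewrite lk.
have [k' [tk' lk' ok']] := coding_onto cG false on'.
by have := kmax k'; rewrite /= lk' lk eqxx ok' tk' /= => /(_ isT); lia.
Qed.

(** Induction on the number of gluings between [b] and the strand of [h]. If [b] has a crossing,
    [e_wrap] continues the walk from [p b]; otherwise the given path already starts anew on
    [p b]. *)
Let e_reaches i k b h : reaches p c 0 b (tm k) (lab k) -> lab h = iter i p b -> connect e k h.
Proof.
elim: i k b => [|i IH] k b Hr /=.
  move=> lE; case/reaches_inv: Hr => [[lE' _ _ _]|[none _]]; first by rewrite e_strand ?lE'.
  by apply: (implyN_absurd (none (tm h))); rewrite // -lE (coding_on cG).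
rewrite -iterS iterSr => lE.
case/reaches_inv: Hr => [[lE' _ _ _]|[_ Hr]]; last exact: IH Hr lE.
have [k' kk' Hr'] := e_wrap k.
by apply: connect_trans kk' _; apply: IH lE; rewrite -lE'.
Qed.

(** Unicursal components with vertices thus become cycles of [p], the form in which the circles
    created by [erase] can be counted. *)
Lemma component_connect h h' : connect e h h' = fconnect p (lab h) (lab h').
Proof.
apply/idP/idP => [/connectP[s sP ->]|/iter_findex].
  elim: s h sP => [|k s IH] h /=; first by rewrite connect0.
  case/andP => hk /IH; apply: connect_trans.
  case/orP: hk => /eqP ->; first by have [_ -> _] := coding_opp cG h; apply: connect0.
  have [oh|oh] := boolP (ori h).
    by have [_] := coding_mate cG oh; apply: reaches_fconnect.
  rewrite fconnect_sym; last exact: perm_inj.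
  have om : ori (mate h) by rewrite coding_mate_ori.
  by have [_] := coding_mate cG om; rewrite mateK; apply: reaches_fconnect.
case: (findex _ _ _) => [|i] lE; first exact: e_strand.
have [k hk Hr] := e_wrap h; apply: connect_trans hk _.
by apply: (e_reaches (i := i) Hr); rewrite -iterSr lE.
Qed.

End CodingTheory.
End Chords.

Lemma half_edge_at (G : framed4graph) (v : vertex G) : exists h, vert h == v.
Proof.
have : 0 < #|[set h | vert h == v]| by rewrite degree4.
by case/card_gt0P => h; rewrite inE; exists h.
Qed.

(** * Graphs with a common code are isomorphic *)

Section Transport.
Variables (T : finType) (p : {perm T}) (c : seq {set T}).
Variables (G H : framed4graph).
Variables (tm : half_edge G -> nat) (lab : half_edge G -> T) (ori : half_edge G -> bool).
Variables (tm' : half_edge H -> nat) (lab' : half_edge H -> T) (ori' : half_edge H -> bool).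
Hypotheses (cG : coding p c tm lab ori) (cH : coding p c tm' lab' ori').

(** The triple of time, strand and direction identifies a half-edge, so the isomorphism has to
    preserve it. *)
Fact transport_subproof h :
  exists k, [&& tm' k == tm h, lab' k == lab h & ori' k == ori h].
Proof.
have [k [t l o]] := coding_onto cH (ori h) (coding_on cG h).
by exists k; rewrite t l o !eqxx.
Qed.
Definition transport h : half_edge H := xchoose (transport_subproof h).

Lemma transportE h :
  [/\ tm' (transport h) = tm h, lab' (transport h) = lab h & ori' (transport h) = ori h].
Proof.
by have /and3P[/eqP t /eqP l /eqP o] := xchooseP (transport_subproof h); split.
Qed.

Lemma transport_opp h : opp (transport h) = transport (opp h).
Proof.
have [t l o] := transportE h; have [t1 l1 o1] := transportE (opp h).
have [t2 l2 o2] := coding_opp cG h; have [t3 l3 o3] := coding_opp cH (transport h).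
by apply: (coding_inj cH); congruence.
Qed.

Lemma transport_mate h : mate (transport h) = transport (mate h).
Proof.
have out k : ori k -> mate (transport k) = transport (mate k).
  move=> ok; have [om Hr] := coding_mate cG ok.
  have [t l o] := transportE k; have [t1 l1 o1] := transportE (mate k).
  by apply: (coding_reaches_mate cH); rewrite ?o ?o1 ?om // t l t1 l1.
have [oh|oh] := boolP (ori h); first exact: out.
by rewrite -{1}[h]mateK -out ?mateK // (coding_mate_ori cG).
Qed.

Definition transport_vertex v := vert (transport (xchoose (half_edge_at v))).

Lemma transport_vert h : vert (transport h) = transport_vertex (vert h).
Proof.
apply/(coding_vert cH); rewrite /transport_vertex.
set k := xchoose _; have [-> _ _] := transportE k; have [-> _ _] := transportE h.
exact/(coding_vert cG)/esym/eqP/(xchooseP (half_edge_at _)).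
Qed.

End Transport.

Lemma transportK (T : finType) (p : {perm T}) c G H tm lab ori tm' lab' ori'
    (cG : @coding T p c G tm lab ori) (cH : @coding T p c H tm' lab' ori') :
  cancel (transport cG cH) (transport cH cG).
Proof.
move=> h; have [t l o] := transportE cG cH h.
have [t1 l1 o1] := transportE cH cG (transport cG cH h).
by apply: (coding_inj cG); congruence.
Qed.

Lemma transport_vertexK (T : finType) (p : {perm T}) c G H tm lab ori tm' lab' ori'
    (cG : @coding T p c G tm lab ori) (cH : @coding T p c H tm' lab' ori') :
  cancel (transport_vertex cG cH) (transport_vertex cH cG).
Proof.
move=> v; rewrite {2}/transport_vertex -transport_vert transportK.
exact/eqP/(xchooseP (half_edge_at _)).
Qed.

Lemma coded_iso (T : finType) (p : {perm T}) c G H :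
  coded p c G -> coded p c H -> framed_iso G H.
Proof.
move=> [tm [lab [ori cG]]] [tm' [lab' [ori' cH]]].
exists (transport_vertex cG cH), (transport cG cH); split.
- by split; [exists (transport_vertex cH cG) | exists (transport cH cG)];
    do [exact: transport_vertexK | exact: transportK].
- exact: transport_vert.
- exact: transport_opp.
- exact: transport_mate.
- by rewrite (coding_circles cG) (coding_circles cH).
Qed.

(** * Changes of code that keep the graph *)

Section Recoding.
Variable T : finType.
Implicit Types (p : {perm T}) (c u v : seq {set T}) (a b : T) (t m : nat).

Lemma on_cat u v t a :
  on (u ++ v) t a = if t < size u then on u t a else on v (t - size u) a.
Proof. by rewrite /on nth_cat; case: ifP. Qed.

Lemma coded_del0 p u v G : coded p (u ++ set0 :: v) G -> coded p (u ++ v) G.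
Proof.
move=> [tm [lab [ori cG]]]; set m := size u.
(* Times after [m] drop by one. This identifies [m] with [m.+1], but it is injective on the times
   different from [m], and no half-edge has time [m]. *)
pose sh t := t - (m < t).
have onE t a : on (u ++ set0 :: v) t a = (t != m) && on (u ++ v) (sh t) a.
  rewrite !on_cat -/m /sh; have [tm'|mt|->] := ltngtP t m.
  - by rewrite subn0 tm'.
  - rewrite ifF; last by lia.
    by have -> : t - m = (t - 1 - m).+1 by lia.
  - by rewrite subnn /on /= inE.
have sh_inj t t' : t != m -> t' != m -> sh t = sh t' -> t = t' by rewrite /sh; lia.
have tm_neq h : tm h != m by have := coding_on cG h; rewrite onE; case/andP.
have shK t : exists2 t', t' != m & sh t' = t.
  by exists (t + (m <= t)); rewrite /sh; lia.
have reachesE k a t b : reaches p (u ++ set0 :: v) k a t b ->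
    reaches p (u ++ v) (sh k) a (sh t) b.
  elim=> {k a t b} [k a t kt|k a t b none _].
    rewrite onE => /andP[tneq ta] none.
    apply: Reaches_here => // [|j]; first by rewrite /sh; lia.
    have [t' t'm <-] := shK j => lt'.
    by have := none t'; rewrite onE t'm => -> //; move: lt' t'm tneq; rewrite /sh; lia.
  rewrite {1}/sh ltn0 => Hr; apply: Reaches_wrap => // j.
  have [t' t'm <-] := shK j => lt'.
  by have := none t'; rewrite onE t'm => -> //; move: lt' t'm; rewrite /sh; lia.
exists (sh \o tm), lab, ori; split=> /=.
- by move=> h; have := coding_on cG h; rewrite onE => /andP[].
- move=> t a o; have [t' t'm <-] := shK t => ta.
  have := coding_onto cG o (t := t') (a := a).
  by rewrite onE t'm ta => /(_ isT)[h [<- <- <-]]; exists h.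
- by move=> h h' /sh_inj-/(_ (tm_neq _) (tm_neq _)); apply: (coding_inj cG).
- move=> h h'; split=> [/(coding_vert cG) -> //|].
  by move/sh_inj => /(_ (tm_neq _) (tm_neq _)) /(coding_vert cG).
- by move=> h; case: (coding_opp cG h) => ->.
- move=> h oh; have [om /reachesE Hr] := coding_mate cG oh; split=> //.
  by have -> : (sh (tm h)).+1 = sh (tm h).+1 by move: (tm_neq h); rewrite /sh; lia.
- rewrite (coding_circles cG); apply: eq_free_strands => a.
  split=> [[t]|[t]]; first by rewrite onE => /andP[_ ta]; exists (sh t).
  by have [t' t'm <-] := shK t => ta; exists t'; rewrite onE t'm.
Qed.

Lemma coded_filter p c G :
  coded p c G -> coded p (filter (predC1 set0) c) G.
Proof.
rewrite -[c in coded _ c]cat0s -[filter _ _]cat0s.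
elim: c [::] => [|A c IH] u //=; have [->|A0] := eqVneq A set0 => /=.
  by move/coded_del0/IH.
by rewrite -!cat_rcons; apply: IH.
Qed.

Lemma on_block u x v i a : i < size x -> on (u ++ x ++ v) (size u + i) a = on x i a.
Proof. by move=> ix; rewrite !on_cat ltnNge leq_addr /= addKn ix. Qed.

Lemma on_out u x y v j a : size x = size y -> ~~ (size u <= j < size u + size x) ->
  on (u ++ x ++ v) j a = on (u ++ y ++ v) j a.
Proof.
move=> xy; rewrite !on_cat -xy negb_and -!leqNgt => /orP[ju|xj]; first by rewrite ltnNge ju.
by case: ifP => // uj; rewrite !ifF //; lia.
Qed.

(** No strand meets both crossings. Hence a path entering the block stops at the same crossing in
    both orders, and a path starting at one of the two crossings ignores the other, so its starting
    time may be moved across the block. *)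
Lemma coded_swap p u (A B : {set T}) v G : [disjoint A & B] ->
  coded p (u ++ [:: A; B] ++ v) G -> coded p (u ++ [:: B; A] ++ v) G.
Proof.
move=> dAB [tm [lab [ori cG]]]; set m := size u.
set c := u ++ _ ++ v in cG; set c' := u ++ _ ++ v.
have cA a : on c m a = (a \in A) by rewrite -[m]addn0 on_block.
have cB a : on c m.+1 a = (a \in B) by rewrite -[m.+1]addn1 on_block.
have c'B a : on c' m a = (a \in B) by rewrite -[m]addn0 on_block.
have c'A a : on c' m.+1 a = (a \in A) by rewrite -[m.+1]addn1 on_block.
have out j a : ~~ (m <= j < m.+2) -> on c j a = on c' j a.
  by move=> jm; apply: on_out; rewrite //= addn2.
have AB a : a \in A -> a \in B -> False.
  by move=> aA; rewrite (disjointFr dAB aA).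
pose sw t := if t == m then m.+1 else if t == m.+1 then m else t.
have blk t : (m <= t < m.+2) = (t == m) || (t == m.+1) by lia.
have sw_m : sw m = m.+1 by rewrite /sw eqxx.
have sw_m1 : sw m.+1 = m by rewrite /sw eqxx ifF //; lia.
have sw_out t : ~~ (m <= t < m.+2) -> sw t = t.
  by rewrite blk /sw => /norP[/negbTE-> /negbTE->].
have swE t : [\/ t = m, t = m.+1 | ~~ (m <= t < m.+2)].
  rewrite blk; have [->|tm0] := eqVneq t m; first by constructor 1.
  by have [->|tm1] := eqVneq t m.+1; [constructor 2|constructor 3].
have swK : involutive sw.
  by move=> t; case: (swE t) => [->|->|h]; rewrite ?sw_m ?sw_m1 ?sw_m ?(sw_out t) ?(sw_out t).
have onE t a : on c' (sw t) a = on c t a.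
  case: (swE t) => [->|->|h]; rewrite ?sw_m ?sw_m1 ?sw_out //.
  - by rewrite cA c'A.
  - by rewrite cB c'B.
  - by rewrite out.
have in_cc' j d : m <= j < m.+2 -> on c j d -> exists2 i, m <= i < m.+2 & on c' i d.
  rewrite blk => jm jd; exists (sw j); rewrite ?onE //.
  by case/orP: jm => /eqP ->; rewrite ?sw_m ?sw_m1; lia.
have in_c'c j d : m <= j < m.+2 -> on c' j d -> exists2 i, m <= i < m.+2 & on c i d.
  rewrite blk -[j in on _ j]swK onE => jm jd; exists (sw j) => //.
  by case/orP: jm => /eqP ->; rewrite ?sw_m ?sw_m1; lia.
have reachesE k a t b : reaches p c k a t b -> (k <= m) || (m.+2 <= k) ->
    reaches p c' k a (sw t) b.
  move=> Hr km; have tb := reaches_on Hr.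
  have [t' Hr'] := reaches_block out in_cc' in_c'c Hr km.
  have t'b := reaches_on Hr'.
  have [tm2|tm2 t't] := boolP (m <= t < m.+2); last by rewrite sw_out // -t't.
  case=> t'm2 _ _; suff -> : sw t = t' by [].
  move: t'm2 tm2; rewrite !blk => /orP[] /eqP t'E /orP[] /eqP tE; move: tb t'b;
    rewrite tE t'E ?sw_m ?sw_m1 ?cA ?cB ?c'A ?c'B => Hx Hy //.
  - by have := AB _ Hx Hy.
  - by have := AB _ Hy Hx.
exists (sw \o tm), lab, ori; split=> /=.
- by move=> h; rewrite onE (coding_on cG).
- move=> t a o; rewrite -[t]swK onE => ta.
  by have [h [<- <- <-]] := coding_onto cG o ta; exists h.
- by move=> h h' /(can_inj swK); apply: (coding_inj cG).
- move=> h h'; split=> [/(coding_vert cG) -> //|].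
  by move/(can_inj swK) => /(coding_vert cG).
- by move=> h; case: (coding_opp cG h) => ->.
- move=> h oh; have [om Hr] := coding_mate cG oh; split=> //.
  have hon := coding_on cG h.
  case: (swE (tm h)) => [hE|hE|hm].
  + rewrite hE sw_m; apply: reachesE; last by lia.
    rewrite hE in Hr hon; apply: (reaches_skip (leqnSn _) _).1 Hr => j jm.
    have -> : j = m.+1 by lia.
    by rewrite cB; apply/negP; apply: AB; rewrite -cA.
  + rewrite hE sw_m1; rewrite hE in Hr hon.
    apply: (reaches_skip (leqnSn _) _).2 => [j jm|].
      have -> : j = m.+1 by lia.
      by rewrite c'A; apply/negP => /AB; apply; rewrite -cB.
    by apply: reachesE => //; lia.
  + by rewrite (sw_out (tm h)) //; apply: reachesE => //; lia.
- rewrite (coding_circles cG); apply: eq_free_strands => a.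
  by split=> -[t ta]; exists (sw t); rewrite ?onE // -onE swK.
Qed.

End Recoding.

(** * Reidemeister moves on codes *)

Lemma framed_iso_refl G : framed_iso G G.
Proof. by exists id, id; split=> //; split; exists id. Qed.

Lemma n_comp_split (T : finType) (e : rel T) (A B : {pred T}) :
  {subset A <= B} -> n_comp e B = n_comp e A + n_comp e [predD B & A].
Proof.
move=> AB; rewrite /n_comp_mem -(cardID A) /=; congr (_ + _); apply: eq_card => x; rewrite !inE.
- by have [/AB ->|] := boolP (x \in A); rewrite ?andbT ?andbF.
- by rewrite andbCA.
Qed.

Lemma next_half_inj (G : framed4graph) : injective (@next_half G).
Proof. exact: inj_comp (inv_inj (@mateK G)) (inv_inj (@oppK G)). Qed.

Section FreeStrand.
Variable T : finType.
Implicit Types (p : {perm T}) (c : seq {set T}) (a b : T).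

Lemma free_strandP p c a :
  reflect (forall b t, fconnect p a b -> ~~ on c t b) (a \in free_strand p c).
Proof.
rewrite unfold_in; apply: (iffP forallP) => free b.
  move=> t ab; move: (free b); rewrite ab; apply: contra => tb.
  by apply/hasP_on; exists t.
by apply/implyP => ab; apply/hasP_on => -[t]; apply/negP/free.
Qed.

Lemma free_strand_closed p c : closed (frel p) (free_strand p c).
Proof.
apply: intro_closed; first exact/fconnect_sym/perm_inj.
move=> x y /= /eqP <- /free_strandP free; apply/free_strandP => b t xb.
by apply: free; apply: connect_trans (fconnect1 _ _) xb.
Qed.

End FreeStrand.

(** * Erasing vertices in a code *)

Section EraseCoding.
Variables (T : finType) (p : {perm T}) (c c' : seq {set T}) (G : framed4graph).
Variables (tm : half_edge G -> nat) (lab : half_edge G -> T) (ori : half_edge G -> bool).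
Hypothesis cG : coding p c tm lab ori.
Variables (S : {set vertex G}) (K : pred nat).
Hypothesis SK : forall h, (vert h \in S) = ~~ K (tm h).
Hypothesis cK : forall t a, on c' t a = K t && on c t a.

Let reaches_K k a t b : reaches p c k a t b -> K t -> reaches p c' k a t b.
Proof.
elim=> {k a t b} [k a t kt ta none|k a t b none _ IH] Kt.
  by apply: Reaches_here; rewrite // ?cK ?Kt // => j /none; rewrite cK negb_and orbC => ->.
by apply: Reaches_wrap (IH Kt) => j /none; rewrite cK negb_and orbC => ->.
Qed.

Let reaches_NK k a t b t' b' : reaches p c k a t b -> ~~ K t ->
  reaches p c' t.+1 b t' b' -> reaches p c' k a t' b'.
Proof.
move=> H; elim: H => {k a t b} [k a t kt ta none|k a t b none _ IH] Kt Hr.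
  apply: (reaches_skip (leqW kt) _).2 Hr => j /andP[kj]; rewrite ltnS leq_eqVlt cK.
  case/predU1P => [->|jt]; first by rewrite (negbTE Kt).
  by rewrite negb_and none ?orbT // kj.
by apply: Reaches_wrap (IH Kt Hr) => j /none; rewrite cK negb_and orbC => ->.
Qed.

Let reaches_iter h i : ori h = false -> iter i.+1 (@next_half G) h \in kept S ->
    (forall j, 0 < j < i.+1 -> iter j (@next_half G) h \notin kept S) ->
  reaches p c' (tm h).+1 (lab h) (tm (iter i.+1 (@next_half G) h))
    (lab (iter i.+1 (@next_half G) h)).
Proof.
have keptE k : (k \in kept S) = K (tm k) by rewrite inE SK negbK.
elim: i h => [|i IH] h oh.
  by rewrite /= keptE => Kt _; apply: reaches_K => //; apply: (next_half_reaches cG).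
rewrite iterSr => Kt min; apply: (reaches_NK (next_half_reaches cG oh)).
  by rewrite -keptE; apply: (min 1%N).
by apply: IH => // [|j ji]; rewrite ?(next_half_ori cG) // -iterSr; apply: min; lia.
Qed.

Let first_return_half (h : erase_half S) : exists i,
  [/\ val (erase_mate h) = iter i.+1 (@next_half G) (opp (val h)),
      iter i.+1 (@next_half G) (opp (val h)) \in kept S
    & forall j, 0 < j < i.+1 -> iter j (@next_half G) (opp (val h)) \notin kept S].
Proof.
have hK : opp (val h) \in kept S by rewrite inE vert_opp (valP h).
by have [[|i] [i0 iE Ki min]] := first_returnP (@next_half_inj G) hK; last exists i.
Qed.

(** The cycles free in [c'] are of two kinds: those free in [c], which are the circles of [G], and
    those whose crossings exist and are all erased. The map [lab] matches the latter with the
    swallowed components. *)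
Let erase_circlesE : erase_circles S = free_strands p c'.
Proof.
rewrite /erase_circles (coding_circles cG) /free_strands.
rewrite (@n_comp_split _ _ (free_strand p c) (free_strand p c')); last first.
  move=> a /free_strandP free; apply/free_strandP => b t ab.
  by rewrite cK negb_and free ?orbT.
congr addn; set D := [predD _ & _].
have p_sym : connect_sym (frel p) by apply/fconnect_sym/perm_inj.
have e_sym : connect_sym (@component_rel G).
  by move=> x y; rewrite !(component_connect cG) p_sym.
have D_closed : closed (frel p) D.
  by move=> x y xy; rewrite !inE !(free_strand_closed _ xy).
have adj : rel_adjunction lab (frel p) (@component_rel G) D.
  split=> [a|h h' _]; last by rewrite (component_connect cG).
  case/andP => /= aN _; apply: sigW.
  have [b ab /hasP_on[t tb]] : exists2 b, fconnect p a b & has (fun A : {set T} => b \in A) c.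
    move: aN; rewrite unfold_in negb_forall => /existsP[b].
    by rewrite negb_imply negbK => /andP[ab hb]; exists b.
  by have [h [_ hb _]] := coding_onto cG true tb; exists h; rewrite hb.
rewrite (adjunction_n_comp lab p_sym e_sym D_closed adj).
apply: eq_n_comp_r => h; rewrite [in RHS]inE /= [RHS]inE.
have -> : (lab h \in free_strand p c) = false.
  by apply/free_strandP => /(_ (lab h) (tm h) (connect0 _ _)); rewrite (coding_on cG).
apply/forallP/free_strandP => /= [sw b t hb|free k].
  rewrite cK; apply/negP => /andP[Kt tb].
  have [k [kt kb _]] := coding_onto cG true tb.
  by have := sw k; rewrite (component_connect cG) kb hb SK kt Kt.
apply/implyP; rewrite (component_connect cG) SK => /free-/(_ (tm k)).
by rewrite cK (coding_on cG) andbT.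
Qed.

(** In [c'] an erased crossing is an empty set instead of being dropped, so surviving half-edges
    keep their times. A path that ignores the empty sets runs through exactly the erased crossings
    that the first return of [next_half] skips. *)
Lemma coding_erase : @coding T p c' (erase S)
  (fun h => tm (val h)) (fun h => lab (val h)) (fun h => ori (val h)).
Proof.
split=> /=.
- by move=> h; rewrite cK (coding_on cG) andbT -[K _]negbK -SK (valP h).
- move=> t a o; rewrite cK => /andP[Kt ta].
  have [h [ht ha ho]] := coding_onto cG o ta.
  have hS : vert h \notin S by rewrite SK ht Kt.
  by exists (Sub h hS).
- by move=> h h' ? ? ?; apply/val_inj/(coding_inj cG).
- move=> h h'; split=> [/(congr1 val)/(coding_vert cG) //|].
  by move/(coding_vert cG) => ?; apply: val_inj.
- by move=> h; apply: (coding_opp cG).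
- move=> h oh; have [i [mE Ki min]] := first_return_half h.
  have [to lo oo] := coding_opp cG (val h).
  have ohF : ori (opp (val h)) = false by rewrite oo oh.
  rewrite -[first_return _ _ _]/(val (erase_mate h)) mE; split; last first.
    by rewrite -to -lo; apply: reaches_iter.
  by rewrite -{}ohF {Ki mE min}; elim: i.+1 => //= j <-; apply: (next_half_ori cG).
- exact: erase_circlesE.
Qed.

End EraseCoding.

(** Both strands run directly from the first of the two crossings to the second, and the two edges
    so traced form a bigon. Erasing its vertices leaves two empty sets, which are then deleted. *)
Lemma coded_reidemeister2 (T : finType) (p : {perm T}) u (a b : T) v G : a != b ->
    coded p (u ++ [:: [set a; b]; [set a; b]] ++ v) G ->
  exists2 H, isotopic G H & coded p (u ++ v) H.
Proof.
move=> ab [tm [lab [ori cG]]]; set m := size u.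
set c := u ++ _ ++ v in cG.
have c0 d : on c m d = (d == a) || (d == b).
  by rewrite -[m]addn0 on_block //= /on /= !inE.
have c1 d : on c m.+1 d = (d == a) || (d == b).
  by rewrite -[m.+1]addn1 on_block //= /on /= !inE.
have on0a : on c m a by rewrite c0 eqxx.
have on0b : on c m b by rewrite c0 eqxx orbT.
have on1a : on c m.+1 a by rewrite c1 eqxx.
have on1b : on c m.+1 b by rewrite c1 eqxx orbT.
have here d : on c m.+1 d -> reaches p c m.+1 d m.+1 d.
  by move=> dP; apply: Reaches_here => // j; lia.
have [h [ht hl ho]] := coding_onto cG true on0a.
have [k [kt kl ko]] := coding_onto cG true on0b.
have [h' [h't h'l h'o]] := coding_onto cG false on1a.
have [k' [k't k'l k'o]] := coding_onto cG false on1b.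
have mh : mate h = h'.
  by apply: (coding_reaches_mate cG); rewrite ?ho // ht hl h't h'l; apply: here.
have mk : mate k = k'.
  by apply: (coding_reaches_mate cG); rewrite ?ko // kt kl k't k'l; apply: here.
have ba : b <> a by move=> ba; rewrite ba eqxx in ab.
set S := [set vert h; vert (mate h)].
exists (erase S).
  apply: isotopic_move2; exists h, k; rewrite mh mk; split.
  - by split; apply/(coding_vert cG); congruence.
  - by apply/eqP => /(coding_vert cG); rewrite ht h't; lia.
  - by apply/eqP => hk; rewrite hk kl in hl.
  - have [_ lo _] := coding_opp cG h; have [_ lo' _] := coding_opp cG h'.
    by split; apply/eqP => E; apply: ba; [rewrite -kl E lo|rewrite -k'l E lo'].
  - by rewrite -mh; apply: framed_iso_refl.
pose K t := (t != m) && (t != m.+1).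
have vE h1 h2 : (vert h1 == vert h2) = (tm h1 == tm h2).
  by apply/eqP/eqP => /(coding_vert cG).
have SK h1 : (vert h1 \in S) = ~~ K (tm h1).
  by rewrite !inE mh !vE ht h't negb_and !negbK.
rewrite -[v]cat0s; apply: coded_del0; apply: coded_del0.
exists (fun h => tm (val h)), (fun h => lab (val h)), (fun h => ori (val h)).
apply: (coding_erase cG SK) => t d.
rewrite -[u ++ _]/(u ++ [:: set0; set0] ++ v) /K.
have [->|tm0] := eqVneq t m; first by rewrite -[m]addn0 on_block //= /on /= inE.
have [->|tm1] := eqVneq t m.+1; first by rewrite -[m.+1]addn1 on_block //= /on /= inE.
by rewrite (on_out (y := [:: [set a; b]; [set a; b]])) //= addn2; lia.
Qed.

Lemma tperm3E (E : finType) (x1 y1 x2 y2 x3 y3 : E) :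
    uniq [:: x1; y1; x2; y2; x3; y3] ->
    let s := (tperm x1 y1 * tperm x2 y2 * tperm x3 y3)%g in
  [/\ [/\ s x1 = y1, s x2 = y2 & s x3 = y3],
      [/\ s y1 = x1, s y2 = x2 & s y3 = x3]
    & forall z, z \notin [:: x1; y1; x2; y2; x3; y3] -> s z = z].
Proof.
rewrite /= !inE !negb_or -!andbA.
case/and5P=> n12 n13 n14 n15 /and5P[n16 n23 n24 n25 /and5P[n26 n34 n35 n36]].
case/and4P=> n45 n46 n56 _.
have D (x y z : E) : z != x -> z != y -> tperm x y z = z.
  by move=> zx zy; rewrite tpermD // eq_sym.
split; first split; rewrite ?permM.
- by rewrite tpermL !D // eq_sym.
- by rewrite (D x1) ?tpermL ?D // eq_sym.
- by rewrite (D x1) ?(D x2) ?tpermL // eq_sym.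
- split.
  + by rewrite tpermR !D // eq_sym.
  + by rewrite (D x1) ?tpermR ?D // eq_sym.
  + by rewrite (D x1) ?(D x2) ?tpermR // eq_sym.
- move=> z; rewrite !inE !negb_or => /and5P[? ? ? ? /andP[? ?]].
  by rewrite !permM !D.
Qed.

Lemma ltnS_eq m j : m <= j < m.+1 -> j = m.
Proof. by lia. Qed.

(* The move reverses each of the three arcs inside the triangle: the first and the
   third crossing exchange their times, and the three crossings are traversed
   backwards, so [ori] is negated there. *)
Lemma coded_reidemeister3 (T : finType) (p : {perm T}) u (a b d : T) v G :
    uniq [:: a; b; d] ->
    coded p (u ++ [:: [set a; b]; [set a; d]; [set b; d]] ++ v) G ->
  exists2 H, isotopic G H &
    coded p (u ++ [:: [set b; d]; [set a; d]; [set a; b]] ++ v) H.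
Proof.
move=> abd [tm [lab [ori cG]]]; set m := size u.
set c := u ++ _ in cG; set c' := u ++ _.
move: abd; rewrite /= !inE negb_or !andbT => /andP[/andP[ab ad] bd].
have c0 e : on c m e = (e == a) || (e == b).
  by rewrite -[m]addn0 on_block //= /on /= !inE.
have c1 e : on c m.+1 e = (e == a) || (e == d).
  by rewrite -[m.+1]addn1 on_block //= /on /= !inE.
have c2 e : on c m.+2 e = (e == b) || (e == d).
  by rewrite -[m.+2]addn2 on_block //= /on /= !inE.
have c'0 e : on c' m e = (e == b) || (e == d).
  by rewrite -[m]addn0 on_block //= /on /= !inE.
have c'1 e : on c' m.+1 e = (e == a) || (e == d).
  by rewrite -[m.+1]addn1 on_block //= /on /= !inE.
have c'2 e : on c' m.+2 e = (e == a) || (e == b).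
  by rewrite -[m.+2]addn2 on_block //= /on /= !inE.
pose blk t := m <= t < m.+3.
have out j e : ~~ blk j -> on c j e = on c' j e.
  by move=> jm; apply: on_out; rewrite //= addn3.
have blkE t : blk t = [|| t == m, t == m.+1 | t == m.+2] by rewrite /blk; lia.
have tE t : [\/ t = m, t = m.+1, t = m.+2 | ~~ blk t].
  rewrite blkE; have [->|tm0] := eqVneq t m; first by constructor 1.
  have [->|tm1] := eqVneq t m.+1; first by constructor 2.
  by have [->|tm2] := eqVneq t m.+2; [constructor 3|constructor 4].
pose sw t := if t == m then m.+2 else if t == m.+2 then m else t.
have sw0 : sw m = m.+2 by rewrite /sw eqxx.
have sw1 : sw m.+1 = m.+1 by rewrite /sw !ifF //; lia.
have sw2 : sw m.+2 = m by rewrite /sw eqxx ifF //; lia.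
have sw_out t : ~~ blk t -> sw t = t.
  by rewrite blkE /sw => /norP[/negbTE-> /norP[_ /negbTE->]].
have swK : involutive sw.
  by move=> t; case: (tE t) => [->|->|->|h]; rewrite ?sw0 ?sw1 ?sw2 ?sw1 ?sw0 ?(sw_out t) ?(sw_out t).
have blk_sw t : blk (sw t) = blk t.
  case: (tE t) => [->|->|->|h]; rewrite ?sw0 ?sw1 ?sw2 ?(sw_out t) // !blkE; lia.
have onE t e : on c' (sw t) e = on c t e.
  case: (tE t) => [->|->|->|h]; first by rewrite sw0 c0 c'2.
  - by rewrite sw1 c1 c'1.
  - by rewrite sw2 c2 c'0.
  - by rewrite sw_out // out.
have in_cc' j e : blk j -> on c j e -> exists2 i, blk i & on c' i e.
  by exists (sw j); rewrite ?blk_sw ?onE.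
have in_c'c j e : blk j -> on c' j e -> exists2 i, blk i & on c i e.
  by exists (sw j); rewrite ?blk_sw // -onE swK.
(* The six outer half-edges of the triangle: on each strand, [x] is where it enters the triangle and
   [y] where it leaves. The move exchanges [x] and [y] on each strand, and their opposites bound the
   edges of the triangle. *)
have [xa [xat xal xao]] : exists h, [/\ tm h = m, lab h = a & ori h = false].
  by apply: (coding_onto cG); rewrite c0 eqxx.
have [xb [xbt xbl xbo]] : exists h, [/\ tm h = m, lab h = b & ori h = false].
  by apply: (coding_onto cG); rewrite c0 eqxx orbT.
have [xd [xdt xdl xdo]] : exists h, [/\ tm h = m.+1, lab h = d & ori h = false].
  by apply: (coding_onto cG); rewrite c1 eqxx orbT.
have [ya [yat yal yao]] : exists h, [/\ tm h = m.+1, lab h = a & ori h].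
  by apply: (coding_onto cG); rewrite c1 eqxx.
have [yb [ybt ybl ybo]] : exists h, [/\ tm h = m.+2, lab h = b & ori h].
  by apply: (coding_onto cG); rewrite c2 eqxx.
have [yd [ydt ydl ydo]] : exists h, [/\ tm h = m.+2, lab h = d & ori h].
  by apply: (coding_onto cG); rewrite c2 eqxx orbT.
have s_uniq : uniq [:: xa; ya; xd; yd; yb; xb].
  apply: (@map_uniq _ _ (fun h => (lab h, ori h))).
  rewrite /= !inE !xpair_eqE xal xdl xbl yal ydl ybl xao yao xdo ydo xbo ybo.
  by rewrite !(eq_sym d) (negbTE ab) (negbTE ad) (negbTE bd) !andbF !eqxx.
have [] := tperm3E s_uniq; set s := (_ * _ * _)%g.
move=> [s_xa s_xd s_yb] [s_ya s_yd s_xb] s_fix.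
have ba : (b == a) = false by rewrite eq_sym (negbTE ab).
have da : (d == a) = false by rewrite eq_sym (negbTE ad).
have db : (d == b) = false by rewrite eq_sym (negbTE bd).
have neq := (negbTE ab, negbTE ad, negbTE bd, ba, da, db).
have tneq : ((m == m.+1) = false) * ((m == m.+2) = false) * ((m.+1 == m) = false)
    * ((m.+1 == m.+2) = false) * ((m.+2 == m) = false) * ((m.+2 == m.+1) = false).
  by clear; do 5! [split; last by lia]; lia.
pose code h := (tm h, lab h, ori h).
have fixE h : code h \notin [:: (m, a, false); (m.+1, a, true); (m.+1, d, false);
    (m.+2, d, true); (m.+2, b, true); (m, b, false)] -> s h = h.
  move=> hP; apply: s_fix; apply: contra hP => /(map_f code).
  by rewrite /= /code xat xal xao yat yal yao xdt xdl xdo ydt ydl ydo ybt ybl ybo xbt xbl xbo.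
have s_out h : ~~ blk (tm h) -> s h = h.
  rewrite blkE !negb_or => /and3P[/negbTE h0 /negbTE h1 /negbTE h2].
  by apply: fixE; rewrite /code !inE !xpair_eqE h0 h1 h2.
have c'_first t t' e : blk t -> on c' t e -> (forall j, m <= j < t -> ~~ on c' j e) ->
    blk t' -> on c' t' e -> (forall j, m <= j < t' -> ~~ on c' j e) -> t = t'.
  move=> /andP[mt _] te tmin /andP[mt' _] t'e t'min; have [tt'|t't|//] := ltngtP t t'.
    by apply: (implyN_absurd (t'min t)); rewrite ?mt.
  by apply: (implyN_absurd (tmin t')); rewrite ?mt'.
pose ori' h := ori h (+) blk (tm h).
have blks : (blk m * blk m.+1 * blk m.+2)%type by rewrite !blkE !eqxx !orbT.
(* A path from outside that arrives at [h] in the old code arrives at [s h] in the new one. If [h]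
   lies in the block, it is one of [xa], [xb], [xd], and [s] sends it to the corresponding [y],
   which now sits at the first crossing of that strand. *)
have key k l h : ori h = false -> reaches p c k l (tm h) (lab h) ->
    (k <= m) || (m.+3 <= k) ->
  ori' (s h) = false /\ reaches p c' k l (sw (tm (s h))) (lab (s h)).
  move=> oh Hr km; have [t' Hr'] := reaches_block out in_cc' in_c'c Hr km.
  rewrite -/(blk _); have [hblk|hblk] := boolP (blk (tm h)); last first.
    by move=> tE'; rewrite s_out // sw_out // -{1}tE' /ori' oh (negbTE hblk).
  case=> t'blk min min'; have t'on := reaches_on Hr'.
  suff [lE oE tE' min1] : [/\ lab (s h) = lab h, ori (s h), blk (tm (s h))
      & forall j, m <= j < sw (tm (s h)) -> ~~ on c' j (lab h)].
    rewrite /ori' oE tE' lE; split=> //.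
    rewrite (c'_first (sw (tm (s h))) t' (lab h)) ?blk_sw //.
    by rewrite onE -lE (coding_on cG).
  have := coding_on cG h.
  case: (tE (tm h)) => [ht|ht|ht|]; last by rewrite hblk.
  - rewrite ht c0 => /orP[]/eqP hl.
    + have -> : h = xa by apply: (coding_inj cG); congruence.
      rewrite s_xa yal yao yat xal sw1 !blks; split=> // j jm.
      by rewrite (ltnS_eq jm) c'0 !neq.
    + have -> : h = xb by apply: (coding_inj cG); congruence.
      by rewrite s_xb ybl ybo ybt xbl sw2 !blks; split=> // j; clear; lia.
  - rewrite ht c1 => /orP[]/eqP hl.
      by apply: (implyN_absurd (min m)); [rewrite ht; clear; lia | rewrite hl c0 eqxx].
    have -> : h = xd by apply: (coding_inj cG); congruence.
    by rewrite s_xd ydl ydo ydt xdl sw2 !blks; split=> // j; clear; lia.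
  - rewrite ht c2 => /orP[]/eqP hl.
      by apply: (implyN_absurd (min m)); [rewrite ht; clear; lia | rewrite hl c0 eqxx orbT].
    by apply: (implyN_absurd (min m.+1)); [rewrite ht; clear; lia | rewrite hl c1 eqxx orbT].
have opp_code h t l o : tm h = t -> lab h = l -> ori h = o ->
    [/\ tm (opp h) = t, lab (opp h) = l & ori (opp h) = ~~ o].
  by move=> <- <- <-; apply: (coding_opp cG).
have [xat' xal' xao'] := opp_code _ _ _ _ xat xal xao.
have [xbt' xbl' xbo'] := opp_code _ _ _ _ xbt xbl xbo.
have [xdt' xdl' xdo'] := opp_code _ _ _ _ xdt xdl xdo.
have [yat' yal' yao'] := opp_code _ _ _ _ yat yal yao.
have [ybt' ybl' ybo'] := opp_code _ _ _ _ ybt ybl ybo.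
have [ydt' ydl' ydo'] := opp_code _ _ _ _ ydt ydl ydo.
have mate_a : mate (opp xa) = opp ya.
  apply: (coding_reaches_mate cG); rewrite ?xao' // xat' xal' yat' yal'.
  by apply: Reaches_here => [//||j]; [rewrite c1 eqxx | by clear; lia].
have mate_b : mate (opp xb) = opp yb.
  apply: (coding_reaches_mate cG); rewrite ?xbo' // xbt' xbl' ybt' ybl'.
  apply: Reaches_here => [//||j jm]; first by rewrite c2 eqxx.
  by rewrite (ltnS_eq jm) c1 !neq.
have mate_d : mate (opp xd) = opp yd.
  apply: (coding_reaches_mate cG); rewrite ?xdo' // xdt' xdl' ydt' ydl'.
  by apply: Reaches_here => [//||j]; [rewrite c2 eqxx orbT | by clear; lia].
have fix_xa : s (opp xa) = opp xa.
  by apply: fixE; rewrite /code xat' xal' xao' !inE !xpair_eqE !eqxx !tneq !neq.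
have fix_xb : s (opp xb) = opp xb.
  by apply: fixE; rewrite /code xbt' xbl' xbo' !inE !xpair_eqE !eqxx !tneq !neq.
have fix_xd : s (opp xd) = opp xd.
  by apply: fixE; rewrite /code xdt' xdl' xdo' !inE !xpair_eqE !eqxx !tneq !neq.
have fix_ya : s (opp ya) = opp ya.
  by apply: fixE; rewrite /code yat' yal' yao' !inE !xpair_eqE !eqxx !tneq !neq.
have fix_yb : s (opp yb) = opp yb.
  by apply: fixE; rewrite /code ybt' ybl' ybo' !inE !xpair_eqE !eqxx !tneq !neq.
have fix_yd : s (opp yd) = opp yd.
  by apply: fixE; rewrite /code ydt' ydl' ydo' !inE !xpair_eqE !eqxx !tneq !neq.
have fixV h : s h = h -> (s^-1)%g h = h by move=> sh; rewrite -{1}sh permK.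
exists (remate s).
  apply: isotopic_move3.
  (* The three vertices are taken in the order of their times, and the edges of the triangle lie on
     the strands [a], [d], [b] in this order. *)
  exists (opp xa), (opp xb), (opp ya), (opp xd), (opp yd), (opp yb); rewrite !oppK.
  split; last exact: framed_iso_refl.
  - by split; apply/(coding_vert cG); congruence.
  - have vne h h' : tm h != tm h' -> vert h != vert h'.
      by apply: contra => /eqP/(coding_vert cG) ->.
    by split; apply: vne; rewrite ?xat' ?yat' ?ydt' ?tneq.
  - by split; rewrite // -mate_b mateK.
  - have lne h h' : lab h != lab h' -> h != h' by apply: contra => /eqP ->.
    by split; split; apply: lne;
      rewrite ?xal' ?xbl' ?yal' ?xdl' ?ydl' ?ybl' ?xal ?yal ?ydl ?neq.
exists (sw \o tm), lab, ori'; split=> /=.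
- by move=> h; rewrite onE (coding_on cG).
- move=> t e o; rewrite -[t]swK onE => te.
  have [h [<- <- ho]] := coding_onto cG (o (+) blk (sw t)) te.
  by exists h; rewrite /ori' ho addbK.
- move=> h h' /(can_inj swK) ht hl; rewrite /ori' ht => /addIb.
  exact: (coding_inj cG).
- move=> h h'; split=> [/(coding_vert cG) -> //|].
  by move/(can_inj swK) => /(coding_vert cG).
- by move=> h; case: (coding_opp cG h) => tO lO oO; rewrite /ori' tO lO oO addNb.
(* In the block, a half-edge that leaves in the new orientation used to enter. Either it is some
   [x], which inherits the former exit of its [y], so [key] applies, or it is some [opp y], joined
   to [opp x] by an edge of the triangle now run backwards. *)
- move=> h; rewrite /remate_mate -/s => oh.
  have := coding_on cG h; have [h0|h0|h0|h0] := tE (tm h).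
  + have oF : ori h = false by move: oh; rewrite /ori' h0 !blks addbT => /negbTE.
    rewrite h0 c0 sw0 => /orP[]/eqP hl.
    * have -> : h = xa by apply: (coding_inj cG); congruence.
      rewrite xal -s_ya permK; have [oM Hr] := coding_mate cG yao.
      apply: key => //; last by clear; lia.
      rewrite yat yal in Hr; apply: (reaches_skip (leqnSn _) _).1 Hr => j jm.
      by rewrite (ltnS_eq jm) c2 !neq.
    * have -> : h = xb by apply: (coding_inj cG); congruence.
      rewrite xbl -s_yb permK; have [oM Hr] := coding_mate cG ybo.
      by rewrite ybt ybl in Hr; apply: key => //; clear; lia.
  + have oF : ori h = false by move: oh; rewrite /ori' h0 !blks addbT => /negbTE.
    rewrite h0 c1 sw1 => /orP[]/eqP hl.
    * have -> : h = opp ya by apply: (coding_inj cG); rewrite ?yat' ?yal' ?yao' ?yao.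
      rewrite (fixV _ fix_ya) -mate_a mateK fix_xa /ori' xao' xat' blks sw0 mate_a yal' xal'.
      by split=> //; apply: Reaches_here; rewrite ?c'2 ?eqxx // => j; clear; lia.
    * have -> : h = xd by apply: (coding_inj cG); congruence.
      rewrite xdl -s_yd permK; have [oM Hr] := coding_mate cG ydo.
      rewrite ydt ydl in Hr; have [|oK Hr'] := key _ _ _ oM Hr; [by clear; lia | split=> //].
      apply: (reaches_skip (leqnSn _) _).2 Hr' => j jm.
      by rewrite (ltnS_eq jm) c'2 !neq.
  + have oF : ori h = false by move: oh; rewrite /ori' h0 !blks addbT => /negbTE.
    rewrite h0 c2 sw2 => /orP[]/eqP hl.
    * have -> : h = opp yb by apply: (coding_inj cG); rewrite ?ybt' ?ybl' ?ybo' ?ybo.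
      rewrite (fixV _ fix_yb) -mate_b mateK fix_xb /ori' xbo' xbt' blks sw0 mate_b ybl' xbl'.
      split=> //; apply: Reaches_here; rewrite ?c'2 ?eqxx ?orbT // => j jm.
      by rewrite (ltnS_eq jm) c'1 !neq.
    * have -> : h = opp yd by apply: (coding_inj cG); rewrite ?ydt' ?ydl' ?ydo' ?ydo.
      rewrite (fixV _ fix_yd) -mate_d mateK fix_xd /ori' xdo' xdt' blks sw1 mate_d ydl' xdl'.
      by split=> //; apply: Reaches_here; rewrite ?c'1 ?eqxx ?orbT // => j; clear; lia.
  + have oT : ori h by move: oh; rewrite /ori' (negbTE h0) addbF.
    have [oM Hr] := coding_mate cG oT.
    by move=> _; rewrite (fixV _ (s_out _ h0)) sw_out //; apply: key => //; move: h0; rewrite /blk; clear; lia.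
- rewrite (coding_circles cG); apply: eq_free_strands => e.
  by split=> -[t te]; exists (sw t); rewrite ?onE // -onE swK.
Qed.

(** * The code of a braid closure *)

(** With [f] sending the top position of a strand to its position further down, this renames
    crossings seen further down by top positions. *)
Definition pull (T : finType) (f : T -> T) (A : {set T}) : {set T} := f @^-1: A.

Lemma on_pull (T : finType) (f : T -> T) (c : seq {set T}) t a :
  on (map (pull f) c) t a = on c t (f a).
Proof.
rewrite /on; have [tc|ct] := ltnP t (size c); first by rewrite (nth_map set0) // inE.
by rewrite !nth_default ?size_map // !inE.
Qed.

Section WordCode.
Variable n : nat.
Implicit Types (w u v : word n.+1) (g : generator n.+1).

(** Permutations compose from left to right, so this sends the top position of a strand to its
    bottom position. *)
Definition braid_perm w : {perm 'I_n.+1} := (\prod_(g <- w) letter_perm (Some g))%g.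

Definition letter_chord g : {set 'I_n.+1} :=
  if g is inl i then [set left_pos i; right_pos i] else set0.

(* The strands are labelled by their positions at level 0; the virtual letters
   contribute empty sets. *)
Fixpoint word_chords w : seq {set 'I_n.+1} :=
  if w is g :: w' then
    letter_chord g :: map (pull (letter_perm (Some g))) (word_chords w')
  else [::].

Lemma braid_perm_cons g w : braid_perm (g :: w) = (letter_perm (Some g) * braid_perm w)%g.
Proof. by rewrite /braid_perm big_cons. Qed.

Lemma braid_perm_cat u v : braid_perm (u ++ v) = (braid_perm u * braid_perm v)%g.
Proof. by rewrite /braid_perm big_cat. Qed.

Lemma braid_perm_nil : braid_perm [::] = 1%g.
Proof. by rewrite /braid_perm big_nil. Qed.

Lemma size_word_chords w : size (word_chords w) = size w.
Proof. by elim: w => //= g w IH; rewrite size_map IH. Qed.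

Lemma word_chords_cat u v : word_chords (u ++ v) =
  word_chords u ++ map (pull (braid_perm u)) (word_chords v).
Proof.
elim: u => [|g u IH] /=.
  rewrite -[LHS]map_id; apply: eq_map => A; apply/setP => x.
  by rewrite inE braid_perm_nil perm1.
rewrite IH map_cat -map_comp; congr (_ :: _ ++ _); apply: eq_map => A.
by apply/setP => x; rewrite /= !inE braid_perm_cons permM.
Qed.

Lemma on_word_chords w k a : on (word_chords w) k a =
  if onth w k is Some g then braid_perm (take k w) a \in letter_chord g else false.
Proof.
elim: w k a => [|g w IH] [|k] a //=; rewrite ?braid_perm_nil ?perm1 //.
- by rewrite /on /= inE.
- by rewrite /on /= inE.
rewrite -[LHS]/(on (map (pull (letter_perm (Some g))) (word_chords w)) k a).
by rewrite on_pull IH; case: onth => // g'; rewrite braid_perm_cons permM.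
Qed.

End WordCode.

Section ClosureCode.
Variables (n : nat) (w : word n.+1).
Let p := braid_perm w.
Let c := word_chords w.

(** The top position of the strand through [x], found by undoing the letters above [x]. *)
Definition point_label (x : point w) : 'I_n.+1 := (braid_perm (take x.1 w))^-1%g x.2.

Lemma entering_on x : (x \in @entering n w) = on c x.1 (point_label x).
Proof.
rewrite on_word_chords unfold_in /entering /letter /point_label permKV.
by case: onth => [[i|i]|] //; rewrite !inE.
Qed.

Lemma descend_last (x : point w) : x.1 = size w :> nat ->
  (descend x).1 = 0 :> nat /\ point_label (descend x) = p (point_label x).
Proof.
move=> xw; rewrite /point_label /descend /= /letter xw modnn take0 take_size.
rewrite braid_perm_nil invg1 perm1 -/p permKV onth_default //.
by rewrite /= perm1.
Qed.

Lemma descend_next (x : point w) : x.1 < size w ->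
  (descend x).1 = x.1.+1 :> nat /\ point_label (descend x) = point_label x.
Proof.
move=> xw; rewrite /point_label /descend /= /letter modn_small //.
have := xw; rewrite -onthTE; case E: (onth w x.1) => [g|] // _; split=> //.
rewrite (take_nth g xw) (onth_nth _ _ _ _ E) -cats1 braid_perm_cat invMg permM.
by rewrite /braid_perm big_seq1 permK.
Qed.

Lemma iter_descend_reaches i (x : point w) :
    iter i (@descend n w) x \in @entering n w ->
    (forall j, j < i -> iter j (@descend n w) x \notin @entering n w) ->
  reaches p c x.1 (point_label x) (iter i (@descend n w) x).1
    (point_label (iter i (@descend n w) x)).
Proof.
elim: i x => [|i IH] x.
  by rewrite /= entering_on => xon _; apply: Reaches_here => // j; lia.
rewrite iterSr => yE min; have x0 : ~~ on c x.1 (point_label x).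
  by rewrite -entering_on; apply: (min 0).
have Hr : reaches p c (descend x).1 (point_label (descend x))
    (iter i (@descend n w) (descend x)).1
    (point_label (iter i (@descend n w) (descend x))).
  by apply: IH => // j ji; rewrite -iterSr; apply: min.
have [xw|wx] := ltnP x.1 (size w).
  have [e1 e2] := descend_next xw; rewrite e1 e2 in Hr.
  by apply: (reaches_skip (leqnSn _) _).2 Hr => j jx; have -> : j = x.1 by lia.
have xw : x.1 = size w :> nat by apply/eqP; rewrite eqn_leq wx -ltnS ltn_ord.
have [e1 e2] := descend_last xw; rewrite e1 e2 in Hr.
apply: Reaches_wrap Hr => j; rewrite leq_eqVlt => /predU1P[<- //|xj].
by rewrite /on nth_default ?inE // size_word_chords -xw ltnW.
Qed.

Let d_sym : connect_sym (frel (@descend n w)) := fconnect_sym (@descend_inj n w).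

Lemma point_label_inj (x y : point w) :
  x.1 = y.1 -> point_label x = point_label y -> x = y.
Proof. by case: x y => [k q] [l r] /= kl; rewrite /point_label /= kl => /perm_inj ->. Qed.

Lemma point_label0 a : point_label (ord0, a) = a.
Proof. by rewrite /point_label /= take0 braid_perm_nil invg1 perm1. Qed.

Lemma iter_descend_top k a : k <= size w ->
  (iter k (@descend n w) (ord0, a)).1 = k :> nat /\
  point_label (iter k (@descend n w) (ord0, a)) = a.
Proof.
elim: k => [|k IH] kw; first by rewrite point_label0.
have [e1 e2] := IH (ltnW kw).
have [|e3 e4] := @descend_next (iter k (@descend n w) (ord0, a)); first by rewrite e1.
by rewrite iterS e3 e4 e1 e2.
Qed.

Lemma connect_label x : fconnect (@descend n w) x (ord0, point_label x).
Proof.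
rewrite d_sym; have [|e1 e2] := @iter_descend_top x.1 (point_label x).
  by rewrite -ltnS ltn_ord.
have {2}-> : x = iter x.1 (@descend n w) (ord0, point_label x).
  by apply: point_label_inj => //; apply: val_inj.
exact: fconnect_iter.
Qed.

(** One full turn of [descend] takes [(size w).+1] steps, one for each level, and applies [p] to the
    label; within a turn the label is constant. *)
Lemma fconnect_label x y :
  fconnect (@descend n w) x y = fconnect p (point_label x) (point_label y).
Proof.
have p_sym : connect_sym (frel p) by apply/fconnect_sym/perm_inj.
have top a : fconnect (@descend n w) (ord0, a) (ord0, p a).
  have [e1 e2] := iter_descend_top a (leqnn (size w)).
  have [e3 e4] := descend_last e1.
  have <- : iter (size w).+1 (@descend n w) (ord0, a) = (ord0, p a).
    by apply: point_label_inj; rewrite ?point_label0 iterS ?e4 ?e2 //; apply: val_inj.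
  exact: fconnect_iter.
apply/idP/idP.
  case/connectP=> s sP ->{y}; elim: s x sP => [|y s IH] x /=; first by rewrite connect0.
  case/andP=> /eqP <- /IH; apply: connect_trans.
  have [xw|wx] := ltnP x.1 (size w); first by rewrite (descend_next xw).2 connect0.
  have xw : x.1 = size w :> nat by apply/eqP; rewrite eqn_leq wx -ltnS ltn_ord.
  by rewrite (descend_last xw).2 fconnect1.
move/iter_findex => lE; apply: connect_trans (connect_label x) _.
rewrite d_sym; apply: connect_trans (connect_label y) _; rewrite d_sym -{}lE.
elim: (findex _ _ _) => [|i IH]; first exact: connect0.
exact: connect_trans IH (top _).
Qed.

Lemma closure_circlesE : closure_circles w = free_strands p c.
Proof.
rewrite /closure_circles; set D := [pred x | _].
have DE x : (x \in D) = (point_label x \in free_strand p c).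
  rewrite inE; apply/forallP/free_strandP => [free a t xa|free y].
    apply/negP => ta; have tw : t < (size w).+1.
      rewrite ltnS -size_word_chords leqNgt; apply/negP => lt.
      by move: ta; rewrite /on nth_default ?inE // ltnW.
    have [e1 e2] := @iter_descend_top t a (tw : t <= size w).
    have := free (iter t (@descend n w) (ord0, a)).
    by rewrite fconnect_label e2 xa entering_on e1 e2 ta.
  by apply/implyP; rewrite fconnect_label entering_on; apply: free.
have D_closed : closed (frel (@descend n w)) D.
  apply: intro_closed => // x y /connect1; rewrite !DE fconnect_label.
  move=> xy /free_strandP free; apply/free_strandP => b t yb.
  exact/free/(connect_trans xy yb).
have p_sym : connect_sym (frel p) by apply/fconnect_sym/perm_inj.
rewrite (adjunction_n_comp (fun a => (ord0, a)) d_sym p_sym D_closed).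
  by apply: eq_n_comp_r => a; rewrite inE /= DE point_label0.
split=> [x _|a b _]; first by exists (point_label x); apply: connect_label.
by rewrite fconnect_label !point_label0.
Qed.

Lemma closure_coding : @coding _ p c (braid_closure w)
  (fun h => (val h.1).1) (fun h => point_label (val h.1)) (fun h => h.2).
Proof.
split.
- by move=> h; rewrite -entering_on (valP h.1).
- move=> t a o ta; have tw : t <= size w.
    rewrite -size_word_chords leqNgt; apply/negP => lt.
    by move: ta; rewrite /on nth_default ?inE // ltnW.
  have [e1 e2] := iter_descend_top a tw.
  have xE : iter t (@descend n w) (ord0, a) \in @entering n w by rewrite entering_on e1 e2.
  by exists (exist (fun x => x \in @entering n w) _ xE, o).
- case=> [x o] [y o'] /= xy1 xy2 ->; congr pair.
  by apply/val_inj/point_label_inj => //; apply: val_inj.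
- move=> h h'; split=> [/(congr1 (fun k : closure_vertex w => val (val k))) //|e].
  by do 2 apply: val_inj.
- by [].
- case=> x [] // _; split=> //.
  have [k [k0 yE kE min]] := first_returnP (@descend_inj n w) (valP x).
  change (let y := first_return (@descend n w) (@entering n w) (val x) in
    reaches p c (val x).1.+1 (point_label (val x)) y.1 (point_label y)).
  rewrite {}yE; case: k k0 kE min => // k _ kE min.
  (* An entering point lies above a letter, hence not on the last level, so the first step down
     keeps the strand and advances the time by one, as the path of an outgoing half-edge
     requires. *)
  have [|e1 e2] := @descend_next (val x).
    rewrite ltnNge; apply/negP => le; have := valP x.
    by rewrite entering_on /on nth_default ?inE // size_word_chords.
  by rewrite iterSr -e1 -e2; apply: iter_descend_reaches; rewrite -?iterSr // => j jk;
    rewrite -iterSr; apply: min.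
- exact: closure_circlesE.
Qed.
End ClosureCode.

(** * Invariance under the braid relations *)

Section Pull.
Variable T : finType.
Implicit Types (s : {perm T}) (a b : T).

Lemma pull_set2 s a b : pull s [set a; b] = [set (s^-1)%g a; (s^-1)%g b].
Proof.
by apply/setP => x; rewrite !inE !(can2_eq (permK s) (permKV s)).
Qed.

Lemma pull_set0 s : pull s set0 = set0.
Proof. by apply/setP => x; rewrite !inE. Qed.

Lemma pull_tperm2 a b d e : pull (tperm a b) [set d; e] = [set tperm a b d; tperm a b e].
Proof. by rewrite pull_set2 tpermV. Qed.

Lemma pull_eq0 s (A : {set T}) : (pull s A == set0) = (A == set0).
Proof.
apply/eqP/eqP => [/setP A0|->]; last exact: pull_set0.
by apply/setP => x; rewrite -(permKV s x); have := A0 (s^-1%g x); rewrite !inE permKV.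
Qed.

Lemma filter_pull s (c : seq {set T}) :
  filter (predC1 set0) (map (pull s) c) = map (pull s) (filter (predC1 set0) c).
Proof. by rewrite filter_map; congr map; apply: eq_filter => A; rewrite /= pull_eq0. Qed.

(** Both sides are conjugates equal to the transposition of [a] and [d]. *)
Lemma tperm_braid a b d : uniq [:: a; b; d] ->
  (tperm a b * (tperm b d * tperm a b) = tperm b d * (tperm a b * tperm b d))%g.
Proof.
rewrite /= !inE negb_or andbT => /andP[/andP[ab ad] bd].
have tJ (x y : {perm T}) : (x * x = 1)%g -> (x * (y * x) = y ^ x)%g.
  by move=> x2; rewrite conjgE -[(x^-1)%g]mulg1 -x2 mulKg.
by rewrite !tJ ?tperm2 // !tpermJ tpermL tpermR !tpermD // eq_sym.
Qed.

Lemma tperm_comm a b d e : a != d -> a != e -> b != d -> b != e ->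
  (tperm a b * tperm d e = tperm d e * tperm a b)%g.
Proof.
move=> ad ae bd be; have /conjg_fixP/commgP -> // : (tperm a b ^ tperm d e = tperm a b)%g.
by rewrite tpermJ !tpermD // eq_sym.
Qed.

End Pull.

Lemma closure_coded n (w : word n.+1) :
  coded (braid_perm w) (word_chords w) (braid_closure w).
Proof. by do 3 eexists; apply: closure_coding. Qed.

Section Relators.
Variable n : nat.
Implicit Types (i j : 'I_n) (u v x y w : word n.+1).

Lemma left_right_neq i : left_pos i != right_pos i.
Proof. by rewrite -val_eqE /= /bump /= add1n neq_ltn ltnSn. Qed.

Lemma far_positions i j : (i.+1 < j) || (j.+1 < i) ->
  [/\ left_pos i != left_pos j, left_pos i != right_pos j,
      right_pos i != left_pos j & right_pos i != right_pos j].
Proof. by move=> ij; split; rewrite -val_eqE /= /bump /=; lia. Qed.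

Lemma next_positions i j : j = i.+1 :> nat ->
  left_pos j = right_pos i /\ uniq [:: left_pos i; right_pos i; right_pos j].
Proof.
move=> ij; split; first by apply: val_inj; rewrite /= /bump /= ij add1n.
by rewrite /= !inE -!val_eqE /= /bump /=; lia.
Qed.

(** Named by top positions, the three strands cross once in each pair on either side of the triple
    relation, in opposite orders. In the mixed word the two virtual letters bring the strands [a]
    and [b] together, so the only crossing is that of [sigma i]. *)
Lemma word_chords_triple i j : j = i.+1 :> nat ->
  let a := left_pos i in let b := right_pos i in let d := right_pos j in
  [/\ uniq [:: a; b; d],
      word_chords [:: @sigma n.+1 i; @sigma n.+1 j; @sigma n.+1 i] = [:: [set a; b]; [set a; d]; [set b; d]],
      word_chords [:: @sigma n.+1 j; @sigma n.+1 i; @sigma n.+1 j] = [:: [set b; d]; [set a; d]; [set a; b]]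
    & word_chords [:: @zeta n.+1 j; @zeta n.+1 i; @sigma n.+1 j] = [:: set0; set0; [set a; b]] ].
Proof.
move=> /next_positions[].
set a := left_pos i; set b := right_pos i; set d := right_pos j => E U.
have /= := U; rewrite !inE negb_or andbT => /andP[/andP[ab ad] bd].
have ba : b != a by rewrite eq_sym.
have da : d != a by rewrite eq_sym.
have db : d != b by rewrite eq_sym.
split; first (by rewrite ab ad bd); rewrite E -/a -/b -/d ?pull_set0 !pull_tperm2.
- by rewrite !(tpermL, tpermR, tpermD ad bd, tpermD ba da).
- by rewrite !(tpermL, tpermR, tpermD ad bd, tpermD ba da).
- by rewrite !(tpermL, tpermR, tpermD ad bd, tpermD ba da).
Qed.

Lemma relator_perm x y : braid_relator x y -> braid_perm x = braid_perm y.
Proof.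
rewrite /braid_perm => xy; case: xy => {x y} [i j ij|i j ij|i j ij|i j ij|i j ij|i j ij|i|i|i];
  rewrite !big_cons !big_nil ?mulg1 /= ?tperm2 //.
1-3: by have [? ? ? ?] := far_positions ij; apply: tperm_comm.
all: by have [-> /tperm_braid] := next_positions ij.
Qed.

(** The crossings of [v] are pulled back through what precedes it, so equal permutations give a
    common tail. *)
Lemma chords_context u v x y : braid_perm x = braid_perm y -> exists c,
  word_chords (u ++ x ++ v) = word_chords u ++ map (pull (braid_perm u)) (word_chords x) ++ c
  /\ word_chords (u ++ y ++ v) = word_chords u ++ map (pull (braid_perm u)) (word_chords y) ++ c.
Proof.
move=> xy; exists (map (pull (braid_perm u)) (map (pull (braid_perm x)) (word_chords v))).
by rewrite !word_chords_cat !map_cat xy.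
Qed.

Lemma braid_perm_context u v x y : braid_perm x = braid_perm y ->
  braid_perm (u ++ x ++ v) = braid_perm (u ++ y ++ v).
Proof. by rewrite !braid_perm_cat => ->. Qed.

Lemma closure_virtual u v x y : braid_perm x = braid_perm y ->
    filter (predC1 set0) (word_chords x) = filter (predC1 set0) (word_chords y) ->
  isotopic (braid_closure (u ++ x ++ v)) (braid_closure (u ++ y ++ v)).
Proof.
move=> xy fxy; apply: isotopic_iso; have [c [xE yE]] := chords_context u v xy.
have := coded_filter (closure_coded (u ++ x ++ v)).
have := coded_filter (closure_coded (u ++ y ++ v)).
rewrite (braid_perm_context u v xy) xE yE !filter_cat !filter_pull fxy.
by move=> cy cx; apply: coded_iso cx cy.
Qed.

Lemma braid_step_isotopic w w' : braid_step w w' ->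
  isotopic (braid_closure w) (braid_closure w').
Proof.
case=> u v x y xy; have pxy := relator_perm xy.
have pE := braid_perm_context u v pxy.
have [c [xE yE]] := chords_context u v pxy.
have cx := closure_coded (u ++ x ++ v).
have cy := closure_coded (u ++ y ++ v).
rewrite pE xE in cx; rewrite yE in cy.
set s := braid_perm u in cx cy.
case: xy pxy cx cy {pE xE yE} => {x y} => [i j ij|i j ij|i j ij|i j ij|i j ij|i j ij|i|i|i] pxy cx cy.
- have [n1 n2 n3 n4] := far_positions ij; move: cx cy.
  rewrite /= !pull_tperm2 !tpermD // 1?eq_sym // => cx cy; apply: isotopic_iso; apply: coded_iso cy; apply: coded_swap cx.
  rewrite !pull_set2 -setI_eq0; apply/eqP/setP => z; rewrite !inE.
  apply/negP => /andP[/orP[]/eqP-> /orP[]]; rewrite (inj_eq perm_inj); exact/negP.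
- by apply: closure_virtual => //=; rewrite !pull_set0 eqxx.
- have [n1 n2 n3 n4] := far_positions ij; apply: closure_virtual => //=.
  rewrite pull_set0 pull_tperm2 !tpermD ?eqxx //=.
- have [U Eij Eji _] := word_chords_triple ij; move: cx cy.
  rewrite [word_chords (_ :: _)]Eij [word_chords (sigma j :: _)]Eji /= !pull_set2 => cx cy.
  have [|H GH cH] := coded_reidemeister3 _ cx.
    exact: etrans (map_inj_uniq (@perm_inj _ s^-1%g) [:: _; _; _]) U.
  by apply: isotopic_trans GH _; apply/isotopic_iso/(coded_iso cH cy).
- by apply: closure_virtual => //=; rewrite !pull_set0 eqxx.
- have [_ _ _ zE] := word_chords_triple ij; apply: closure_virtual => //.
  by rewrite [word_chords [:: zeta j, _ & _]]zE /= !pull_set0 eqxx.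
- by apply: closure_virtual => //=; rewrite !pull_set0 eqxx.
(* The first letter only exchanges the two strands, so the second crossing is the same unordered
   pair. *)
- move: cx cy; rewrite /= pull_tperm2 tpermL tpermR (setUC [set right_pos i]) pull_set2 => cx cy.
  have [|H GH cH] := coded_reidemeister2 _ cx.
    by rewrite (inj_eq perm_inj) left_right_neq.
  by apply: isotopic_trans GH _; apply/isotopic_iso/(coded_iso cH cy).
- apply: closure_virtual => //=.
  by rewrite !pull_set0 pull_tperm2 tpermL tpermR (setUC [set right_pos i]) eqxx.
Qed.

Lemma braid_equiv_isotopic w w' : braid_equiv w w' ->
  isotopic (braid_closure w) (braid_closure w').
Proof.
elim=> [{}w {}w' /braid_step_isotopic|{}w|{}w {}w' _ /isotopic_sym|w1 w2 w3 _ H12 _] //.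
- exact: isotopic_refl.
- exact: isotopic_trans.
Qed.




End Relators.

(** * Realization of codes by braid words *)

Lemma pull_mul (T : finType) (s t : {perm T}) (c : seq {set T}) :
  map (pull s) (map (pull t) c) = map (pull (s * t)%g) c.
Proof.
by rewrite -map_comp; apply: eq_map => A; apply/setP => x; rewrite /= !inE permM.
Qed.

Section Realization.
Variable n : nat.
Implicit Types (w : word n.+1) (s p : {perm 'I_n.+1}) (c : seq {set 'I_n.+1}).

Let realizes w p c :=
  braid_perm w = p /\ filter (predC1 set0) (word_chords w) = c.

Let realizes_cat w w' p p' c c' : realizes w p c -> realizes w' p' c' ->
  realizes (w ++ w') (p * p')%g (c ++ map (pull p) c').
Proof.
move=> [wp wc] [wp' wc']; split; first by rewrite braid_perm_cat wp wp'.
by rewrite word_chords_cat filter_cat filter_pull wc wc' wp.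
Qed.

(** Induction on the distance: conjugating the transposition of [x] and the position before [y] by
    the virtual crossing of that position with [y] gives the transposition of [x] and [y]. *)
Let realizes_tperm (x y : 'I_n.+1) : exists z, realizes z (tperm x y) [::].
Proof.
wlog xy : x y / x <= y.
  by move=> W; case: (leqP x y) => [|/ltnW] /W //; rewrite tpermC.
have [k] := ubnP (y - x); elim: k x y xy => // k IH x y xy yx.
have [->|xny] := eqVneq x y; first by rewrite tperm1; exists [::]; split; rewrite ?braid_perm_nil.
have {xy xny} xy : x < y by rewrite ltn_neqAle xny.
have yn : y.-1 < n by have := ltn_ord y; lia.
pose i := Ordinal yn.
have yE : y = right_pos i by apply: val_inj; rewrite /= /bump /=; lia.
have zi : realizes [:: zeta (n := n.+1) i] (tperm (left_pos i) y) [::].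
  by split; rewrite /braid_perm ?big_seq1 ?yE //= eqxx.
have [xE|xny] := eqVneq x (left_pos i); first by exists [:: zeta (n := n.+1) i]; rewrite xE.
have xi : x < i by move: xny; rewrite -val_eqE /=; lia.
have [||z rz] := IH x (left_pos i); rewrite /= ?(ltnW xi) //; first by lia.
exists ([:: zeta (n := n.+1) i] ++ (z ++ [:: zeta (n := n.+1) i])).
suff -> : tperm x y = (tperm (left_pos i) y * (tperm x (left_pos i) * tperm (left_pos i) y))%g.
  exact: realizes_cat zi (realizes_cat rz zi).
have tJ (u v : {perm 'I_n.+1}) : (v^-1 = v)%g -> (v * (u * v) = u ^ v)%g.
  by move=> vV; rewrite conjgE vV.
rewrite tJ ?tpermV // tpermJ tpermL tpermD // eq_sym //.
by rewrite -val_eqE /= neq_ltn xy.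
Qed.

Let realizes_perm s : exists z, realizes z s [::].
Proof.
have [ts -> _] := prod_tpermP s; elim: ts => [|t ts [z rz]].
  by exists [::]; split; rewrite ?braid_perm_nil ?big_nil.
have [z' rz'] := realizes_tperm t.1 t.2.
by exists (z' ++ z); rewrite big_cons; apply: realizes_cat rz' rz.
Qed.

(** Induction on the number of crossings: a virtual word brings the first pair to the two leftmost
    positions, where they cross. Once no crossing is left, what remains of the permutation is
    realized virtually. *)
Lemma word_realization p c : all (fun A : {set _} => #|A| == 2) c ->
  exists w, braid_perm w = p /\ filter (predC1 set0) (word_chords w) = c.
Proof.
have [k] := ubnP (size c); elim: k p c => // k IH p [_ _|A c] /=.
  exact: realizes_perm.
rewrite ltnS => ck /andP[/cards2P[a [b [ab AE]]] c2].
have n0 : 0 < n.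
  rewrite lt0n; apply/eqP => n0; move: ab; rewrite -val_eqE /=.
  by have := ltn_ord a; have := ltn_ord b; lia.
pose i := Ordinal n0; pose l := left_pos i; pose r := right_pos i.
have lr : l != r := left_right_neq i.
(* The first factor sends [a] to [l]; the second sends the image of [b] to [r] and fixes [l], since
   neither that image nor [r] is [l]. *)
pose q := (tperm a l * tperm (tperm a l b) r)%g.
have qa : q a = l.
  rewrite permM tpermL tpermD // 1?eq_sym //.
  by rewrite -{1}(tpermL a l) (inj_eq perm_inj).
have qb : q b = r by rewrite permM tpermL.
pose s := (q * tperm l r)%g.
(* After [q] and the crossing, [s] gives the current positions: the other pairs are renamed by them,
   and [s] still has to be completed to [p]. *)
have [||w rw] := IH (s^-1 * p)%g (map (pull s^-1%g) c); rewrite ?size_map //.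
  rewrite all_map; apply: sub_all c2 => B /= /eqP <-; apply/eqP.
  by apply: card_preimset; apply: perm_inj.
have [z rz] := realizes_perm q.
have rs : realizes [:: sigma (n := n.+1) i] (tperm l r) [:: [set l; r]].
  split; rewrite /braid_perm ?big_seq1 //= ifT //.
  by apply/set0Pn; exists l; rewrite !inE eqxx.
exists (z ++ ([:: sigma (n := n.+1) i] ++ w)).
have := realizes_cat rz (realizes_cat rs rw).
rewrite mulgA -/s mulKVg /= !pull_mul -/s mulgV pull_set2.
have -> : map (pull (1%g : {perm _})) c = c.
  by apply: map_id_in => B _; apply/setP => x; rewrite !inE perm1.
by rewrite -qa -qb !permK -AE.
Qed.

End Realization.

(** * Renaming the strands of a code *)

Section Relabel.
Variables (T T' : finType) (f : T -> T') (g : T' -> T).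
Hypotheses (fK : cancel f g) (gK : cancel g f).
Variables (p : {perm T}) (c : seq {set T}).

Let relabel_inj : injective (f \o p \o g).
Proof. exact/(inj_comp (inj_comp (can_inj fK) perm_inj))/(can_inj gK). Qed.
Definition relabel_perm : {perm T'} := perm relabel_inj.

Definition relabel_chords : seq {set T'} := [seq f @: (A : {set T}) | A <- c].

Let relabel_permE a : relabel_perm (f a) = f (p a).
Proof. by rewrite permE /= fK. Qed.

Let on_relabel t a : on relabel_chords t (f a) = on c t a.
Proof.
rewrite /on; have [tc|ct] := ltnP t (size c).
  by rewrite (nth_map set0) // mem_imset //; apply: can_inj fK.
by rewrite !nth_default ?size_map // !inE.
Qed.

Let reaches_relabel k a t b : reaches p c k a t b ->
  reaches relabel_perm relabel_chords k (f a) t (f b).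
Proof.
elim=> {k a t b} [k a t kt ta none|k a t b none _].
  by apply: Reaches_here => [//||j /none]; rewrite on_relabel.
by rewrite -relabel_permE; apply: Reaches_wrap => j /none; rewrite on_relabel.
Qed.

Let fconnect_relabel a b : fconnect relabel_perm (f a) (f b) = fconnect p a b.
Proof.
have iterE i : iter i relabel_perm (f a) = f (iter i p a).
  by elim: i => //= i ->; rewrite relabel_permE.
apply/idP/idP => /iter_findex; first by rewrite iterE => /(can_inj fK) <-; apply: fconnect_iter.
by move=> <-; rewrite -iterE; apply: fconnect_iter.
Qed.

Lemma coded_relabel G : coded p c G -> coded relabel_perm relabel_chords G.
Proof.
case=> tm [lab [ori cG]]; exists tm, (f \o lab), ori; split=> /=.
- by move=> h; rewrite on_relabel (coding_on cG).
- move=> t a o; rewrite -[a]gK on_relabel => /(coding_onto cG o)[h [ht ha ho]].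
  by exists h; rewrite ha.
- by move=> h h' ht /(can_inj fK) hl; apply: (coding_inj cG).
- exact: (coding_vert cG).
- by move=> h; have [-> -> ->] := coding_opp cG h.
- by move=> h /(coding_mate cG)[om /reaches_relabel].
- rewrite (coding_circles cG); apply/esym.
  have freeE a : (f a \in free_strand relabel_perm relabel_chords) = (a \in free_strand p c).
    apply/free_strandP/free_strandP => free b t.
      by rewrite -fconnect_relabel -on_relabel; apply: free.
    by rewrite -[b]gK fconnect_relabel on_relabel; apply: free.
  rewrite /free_strands (adjunction_n_comp (e' := frel p) f).
  + by apply: eq_n_comp_r => a; rewrite inE /= freeE.
  + exact/fconnect_sym/perm_inj.
  + exact/fconnect_sym/perm_inj.
  + exact: free_strand_closed.
  + split=> [a _|a b _]; first by exists (g a); rewrite gK connect0.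
    by rewrite fconnect_relabel.
Qed.

End Relabel.

(** * A code for every graph *)

Section Orientation.
Variable G : framed4graph.
Implicit Types h k : half_edge G.

Lemma next_half_opp_mate h : next_half (opp (mate h)) = h.
Proof. by rewrite /next_half oppK mateK. Qed.

Lemma next_half_opp h : next_half (opp h) = mate h.
Proof. by rewrite /next_half oppK. Qed.

(** A walk from [opp h] to [h] could be shortened by one step at each end, giving such a walk for
    [opp (mate h)]. The descent stops at a fixed point of [opp] or of [mate], and there is none. *)
Lemma iter_next_half_opp i h : iter i (@next_half G) (opp h) != h.
Proof.
have [m] := ubnP i; elim: m i h => // m IH [|[|i]] h im.
- exact: opp_neq.
- by rewrite /= next_half_opp mate_neq.
apply/eqP => hE; have /eqP[] := IH i (opp (mate h)) (ltnW im).
rewrite oppK; apply: next_half_inj.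
by rewrite next_half_opp_mate -iterS -next_half_opp -iterSr.
Qed.

Let r h := froot (@next_half G) h.

Let next_sym : connect_sym (frel (@next_half G)) := fconnect_sym (@next_half_inj G).

Let r_next h : r (next_half h) = r h.
Proof. by apply/esym/rootP => //; apply: fconnect1. Qed.

Let r_opp_neq h : r (opp h) != r h.
Proof.
apply/eqP => /(rootP next_sym)/iter_findex hE.
by have := iter_next_half_opp (findex (@next_half G) (opp h) h) h; rewrite hE eqxx.
Qed.

(** The orbits of [next_half] are the directed components. Those of [h] and [opp h] are the two
    directions of one component and are distinct, so comparing the ranks of their representatives
    selects one direction coherently. *)
Definition outgoing h := enum_rank (r h) < enum_rank (r (opp h)).

Lemma outgoing_opp h : outgoing (opp h) = ~~ outgoing h.
Proof.
rewrite /outgoing oppK -leqNgt [RHS]leq_eqVlt.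
by rewrite (inj_eq (@ord_inj _)) (inj_eq enum_rank_inj) (negbTE (r_opp_neq h)).
Qed.

Lemma outgoing_mate h : outgoing (mate h) = ~~ outgoing h.
Proof.
rewrite -outgoing_opp /outgoing oppK -{1}[mate h]next_half_opp r_next.
by rewrite -(r_next (opp (mate h))) next_half_opp_mate.
Qed.

End Orientation.

Section GraphCode.
Variable G : framed4graph.

Definition incoming := {h : half_edge G | ~~ outgoing h}.

Lemma next_incoming_subproof (x : incoming) : ~~ outgoing (next_half (val x)).
Proof. by rewrite outgoing_mate outgoing_opp negbK (valP x). Qed.
Definition next_incoming (x : incoming) : incoming :=
  Sub (next_half (val x)) (next_incoming_subproof x).

(* One strand for each edge, labelled by its final half-edge, and one for each
   circle component. *)
Definition strand := (incoming + 'I_(circles G))%type.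

Definition next_strand (a : strand) : strand :=
  match a with inl x => inl (next_incoming x) | inr k => inr k end.

Lemma next_strand_inj : injective next_strand.
Proof.
by move=> [x|k] [y|l] //= [] /next_half_inj/val_inj ->.
Qed.

Definition strand_perm : {perm strand} := perm next_strand_inj.

(** An edge is cut just after its strand begins, so its strand passes through the final vertex of
    the edge and meets no other crossing; circle strands meet none. *)
Definition vertex_chord (v : vertex G) : {set strand} :=
  [set a : strand | if a is inl x then vert (val x) == v else false].

Definition graph_chords : seq {set strand} := map vertex_chord (enum {: vertex G}).

Lemma incoming_end_subproof (h : half_edge G) : ~~ outgoing (if outgoing h then opp h else h).
Proof. by case: ifP => [oh|->//]; rewrite outgoing_opp oh. Qed.
Definition incoming_end (h : half_edge G) : incoming :=
  Sub (if outgoing h then opp h else h) (incoming_end_subproof h).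

Lemma on_graph_chords t (x : incoming) :
  on graph_chords t (inl x) = (t == enum_rank (vert (val x))).
Proof.
have sz : size (enum {: vertex G}) = #|vertex G| by rewrite -cardE.
rewrite /on /graph_chords; have [tG|Gt] := ltnP t #|vertex G|; last first.
  rewrite nth_default ?inE; last by rewrite size_map sz.
  apply/esym/negbTE.
  by apply: contraTN Gt => /eqP ->; rewrite -ltnNge.
rewrite (nth_map (vert (val x))) ?sz // inE.
rewrite -[t]/(val (Ordinal tG)) -enum_val_nth (inj_eq (@ord_inj _)).
by rewrite eq_sym (can2_eq enum_valK enum_rankK).
Qed.

Lemma on_graph_chords_circle t k : on graph_chords t (inr k) = false.
Proof.
rewrite /on; have [tG|Gt] := ltnP t (size graph_chords); last by rewrite nth_default ?inE.
have := mem_nth set0 tG; case/mapP => v _ ->; by rewrite inE.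
Qed.

(** At each vertex [opp] pairs incoming with outgoing half-edges, so two of the four are incoming.
    Loops make no exception, as half-edges and not edges are counted. *)
Lemma card_vertex_chord v : #|vertex_chord v| = 2.
Proof.
pose I := [set h | (vert h == v) && ~~ outgoing h].
pose J := [set h | (vert h == v) && outgoing h].
have -> : #|vertex_chord v| = #|I|.
  have -> : vertex_chord v = [set inl x | x in [pred x : incoming | val x \in I]].
    apply/setP => a; rewrite inE; apply/idP/imsetP => [|[x + ->]]; last by rewrite !inE => /andP[].
    by case: a => // x xv; exists x => //; rewrite !inE xv (valP x).
  rewrite card_imset; last by move=> x y [].
  rewrite -(card_imset _ val_inj); apply: eq_card => h.
  apply/imsetP/idP => [[x + ->] //|hI].
  have ho : ~~ outgoing h by move: hI; rewrite inE => /andP[].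
  by exists (Sub h ho).
have IJ : #|I| = #|J|.
  rewrite -(card_imset (mem I) (inv_inj (@oppK G))); apply: eq_card => h.
  apply/imsetP/idP => [[k + ->]|]; first by rewrite !inE vert_opp outgoing_opp.
  by rewrite inE => /andP[hv ho]; exists (opp h); rewrite ?oppK // inE vert_opp outgoing_opp hv ho.
have := degree4 v; rewrite -(cardsID [set h | outgoing h]).
have -> : [set h | vert h == v] :&: [set h | outgoing h] = J by apply/setP => h; rewrite !inE.
have -> : [set h | vert h == v] :\: [set h | outgoing h] = I.
  by apply/setP => h; rewrite !inE andbC.
by rewrite -IJ; lia.
Qed.

Lemma graph_coding : @coding _ strand_perm graph_chords G
  (fun h => enum_rank (vert h)) (fun h => inl (incoming_end h)) (@outgoing G).
Proof.
have end_vert h : vert (val (incoming_end h)) = vert h.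
  by rewrite /=; case: ifP => // _; rewrite vert_opp.
split.
- by move=> h; rewrite on_graph_chords end_vert.
- move=> t [x|k] o; last by rewrite on_graph_chords_circle.
  rewrite on_graph_chords => /eqP ->.
  have xo := negbTE (valP x).
  exists (if o then opp (val x) else val x).
  split; first by case: o; rewrite ?vert_opp.
    congr inl; apply: val_inj; rewrite /=.
    by case: o; rewrite ?outgoing_opp ?xo //= ?oppK.
  by case: o; rewrite ?outgoing_opp xo.
- move=> h h' _ [] + oE; rewrite -oE; case: ifP => // _.
  by move=> /(inv_inj (@oppK G)).
- move=> h h'; split=> [-> //|/ord_inj/enum_rank_inj //].
- move=> h; rewrite vert_opp outgoing_opp; split=> //.
  congr inl; apply: val_inj; rewrite /= outgoing_opp oppK.
  by case: outgoing.
- move=> h oh; have oM : outgoing (mate h) = false by rewrite outgoing_mate oh.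
  (* The only crossing of the strand is behind the point, which therefore passes to the strand of
     the next edge and stops at its crossing. *)
  split=> //; apply: Reaches_wrap => [j hj|].
    by rewrite on_graph_chords end_vert neq_ltn hj orbT.
  have -> : strand_perm (inl (incoming_end h)) = inl (incoming_end (mate h)).
    rewrite permE /=; congr inl; apply: val_inj; rewrite /= oM oh.
    by rewrite next_half_opp.
  by apply: Reaches_here => // [|j jt]; rewrite on_graph_chords end_vert // neq_ltn; move: jt => /= ->.
(* A circle strand is glued to itself, so it is a cycle of its own; every edge strand meets a
   crossing. The free cycles are thus the circles of [G]. *)
- have p_circle k i : iter i strand_perm (inr k) = inr k.
    by elim: i => //= i ->; rewrite permE.
  have p_sym : connect_sym (frel strand_perm) by apply/fconnect_sym/perm_inj.
  rewrite -[LHS]card_ord -(card_imset _ (@inr_inj incoming _)).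
  apply: eq_card => a; rewrite [in RHS]inE; apply/imsetP/andP.
    case=> k _ ->; split.
      apply/eqP; have := connect_root (frel strand_perm) (inr k).
      by move/iter_findex; rewrite p_circle => <-.
    by apply/free_strandP => b t /iter_findex <-; rewrite p_circle on_graph_chords_circle.
  case: a => [x|k] [_ free]; last by exists k.
  move/free_strandP: free => /(_ _ (enum_rank (vert (val x))) (connect0 _ _)).
  by rewrite on_graph_chords eqxx.
Qed.

(** This provides the shape [n.+1] of the number of strands of the braid. *)
Lemma card_strand : 0 < #|{: strand}|.
Proof.
rewrite card_sum card_ord; have := nonempty G; rewrite !addn_gt0.
case/orP=> [/card_gt0P[v _]|->]; last by rewrite orbT.
have [h _] := half_edge_at v; apply/orP; left; apply/card_gt0P.
by exists (incoming_end h).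
Qed.

End GraphCode.

Lemma coded_braid G : exists n (w : word n.+1), framed_iso (braid_closure w) G.
Proof.
have := card_strand G; case E: #|_| => [//|n] _; exists n.
pose f (a : strand G) : 'I_n.+1 := cast_ord E (enum_rank a).
pose g (k : 'I_n.+1) : strand G := enum_val (cast_ord (esym E) k).
have fK : cancel f g by move=> a; rewrite /g /f cast_ordK enum_rankK.
have gK : cancel g f by move=> k; rewrite /g /f enum_valK cast_ordKV.
have cG : coded (strand_perm G) (graph_chords G) G by do 3 eexists; apply: graph_coding.
have cG' := coded_filter (coded_relabel fK gK cG).
have [|w [wp wc]] := @word_realization n (relabel_perm fK gK (strand_perm G))
    (filter (predC1 set0) (relabel_chords f (graph_chords G))).
  rewrite all_filter !all_map; apply/allP => v _ /=; apply/implyP => _.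
  by rewrite card_imset ?card_vertex_chord //; apply: can_inj fK.
exists w; apply: coded_iso cG'.
by rewrite -wp -wc; apply/coded_filter/closure_coded.
Qed.

Theorem theorem2p8 (L : free_link) :
  exists (n : nat) (beta : fB n.+1), free_link_of (Cl beta) = L.
Proof.
have [G LG] := diagramsP L.
have -> : L = free_link_of G by apply: free_link_inj.
have [n [w wG]] := coded_braid G.
exists n, (\pi_(fB n.+1) w)%qT; apply/free_link_ofP.
(* [Cl] closes the chosen representative of the class of [w], which may differ from [w]; invariance
   under the braid relations bridges the two. *)
apply: isotopic_trans (isotopic_iso wG); apply: braid_equiv_isotopic.
by apply/fB_eqP; rewrite reprK.
Qed.
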